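(* Let $n\ge1$. There does not exist a proper extension $(\mathcal{M},P,\alpha)$ of the classical Maslov--Arnold space $(\Lambda(n),P,\alpha_0)$ for which $\mathcal{M}$ is a connected, smoothly embedded submanifold of $Gr_n(\mathbb{R}^{2n})$.
   Context: For $P\in Gr_n(\mathbb{R}^{2n})$ the train of $P$ is $\mathcal{Z}_P=\{W\in Gr_n(\mathbb{R}^{2n}):W\cap P\ne\{0\}\}$, and $\mathcal{Z}_P^1=\{W:\dim(W\cap P)=1\}$, a smooth hypersurface with normal line bundle $\nu$. A loop $\gamma\colon S^1\to Gr_n(\mathbb{R}^{2n})$ is sufficiently generic if it is $C^\infty$, $\gamma(S^1)\cap\mathcal{Z}_P\subseteq\mathcal{Z}_P^1$, and whenever $\gamma(t)\in\mathcal{Z}_P^1$ the velocity $\dot\gamma(t)$ is not tangent to $\mathcal{Z}_P^1$. For $\mathcal{M}\subseteq Gr_n(\mathbb{R}^{2n})$, a co-orientation of $\mathcal{Z}_P^1\cap\mathcal{M}$ is an orientation of the line bundle $\nu|_{\mathcal{Z}_P^1\cap\mathcal{M}}$. Given a co-orientation and a sufficiently generic loop $\gamma\colon S^1\to\mathcal{M}$, the geometric intersection number of $\gamma$ with the train is $\sum_{t\in S^1,\ \gamma(t)\in\mathcal{Z}_P}\mathrm{sgn}(t)$, where $\mathrm{sgn}(t)=\pm1$ according to whether the induced isomorphism $T_tS^1\to\nu_{\gamma(t)}$ preserves or reverses orientation. A rank $n$ Maslov--Arnold (MA) space $(\mathcal{M},P,\alpha)$ consists of a subset $\mathcal{M}\subseteq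 Gr_n(\mathbb{R}^{2n})$, a subspace $P\in Gr_n(\mathbb{R}^{2n})$, and a class $\alpha\in H^1(\mathcal{M};\mathbb{Z})$ of infinite order, such that $\mathcal{Z}_P^1\cap\mathcal{M}$ has a co-orientation for which the geometric intersection number with $\mathcal{Z}_P$ of every sufficiently generic loop $\gamma\colon S^1\to\mathcal{M}$ equals $\langle\alpha,[\gamma]\rangle$. For a symplectic form on $\mathbb{R}^{2n}$, $\Lambda(n)\subseteq Gr_n(\mathbb{R}^{2n})$ is the Lagrangian Grassmannian. The classical Maslov--Arnold space is $(\Lambda(n),P,\alpha_0)$ where $P\in\Lambda(n)$ and $\alpha_0$ is the Maslov class, the generator of $H^1(\Lambda(n);\mathbb{Z})\cong\mathbb{Z}$ canonically determined by the symplectic form. (It is a known theorem of Arnold that this is an MA space.) For MA spaces of equal rank, $(\mathcal{M}_2,P_2,\alpha_2)$ extends $(\mathcal{M}_1,P_1,\alpha_1)$ if $\mathcal{M}_1\subseteq\mathcal{M}_2$, $P_1=P_2$, and $i^*(\alpha_2)=\alpha_1$, where $i\colon\mathcal{M}_1\hookrightarrow\mathcal{M}_2$ is the inclusion. The extension is proper if $\mathcal{M}_1\ne\mathcal{M}_2$. *)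

(* Defs.v *)
From HB Require Import structures.
From mathcomp Require Import all_boot all_order all_algebra.
From mathcomp Require Import ring_quotient.
From mathcomp Require Import complex.
From mathcomp Require Import all_classical all_reals all_analysis.

Set Implicit Arguments.
Unset Strict Implicit.
Unset Printing Implicit Defensive.

Import Order.TTheory GRing.Theory Num.Theory.
Import numFieldNormedType.Exports.

Local Open Scope classical_set_scope.
Local Open Scope ring_scope.
Local Open Scope quotient_scope.

Lemma continuous_mx (T : topologicalType) (R : realType) (m n : nat)
    (f : T -> 'M[R]_(m, n)) :
  (forall i j, continuous (fun x => f x i j)) -> continuous f.
Proof.
move=> cf x A [P nP PA]; apply: (@filterS _ (nbhs x) _ _ _ (fun y => PA (f y))).
apply: filter_forall => i; apply: filter_forall => j.
exact: (cf i j x _ (nP i j)).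
Qed.

Lemma continuous_to_set (T U : topologicalType) (A : set U)
    (f : T -> set_type A) :
  continuous (fun x => set_val (f x)) -> continuous f.
Proof. exact: continuous_comp_initial. Qed.

Lemma set_val_continuous (U : topologicalType) (A : set U) :
  continuous (set_val : set_type A -> U).
Proof. exact: initial_continuous. Qed.

Section Inclusion.
Context (U : topologicalType) (A B : set U) (sAB : A `<=` B).

Definition incl_fun (x : set_type A) : set_type B :=
  exist _ (set_val x) (mem_set (sAB (set_mem (valP x)))).

Lemma incl_fun_continuous : continuous incl_fun.
Proof. by apply: continuous_to_set; exact: set_val_continuous. Qed.

Definition incl : continuousType (set_type A) (set_type B) :=
  mkcts incl_fun_continuous.

End Inclusion.

Section Simplices.
Context (R : realType).

Definition simplex_set (p : nat) : set 'rV[R]_p.+1 :=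
  [set x | (forall i, 0 <= x ord0 i) /\ \sum_i x ord0 i = 1].
Arguments simplex_set : clear implicits.

Definition simplex (p : nat) : topologicalType := set_type (simplex_set p).

(* the i-th face inserts the barycentric coordinate 0 at position i *)
Definition face_row (p : nat) (i : 'I_p.+2) (x : simplex p) : 'rV[R]_p.+2 :=
  \row_j (if unlift i j is Some k then set_val x ord0 k else 0).

Lemma face_rowP p (i : 'I_p.+2) (x : simplex p) :
  face_row i x \in simplex_set p.+1.
Proof.
have [x0 x1] : simplex_set p (set_val x) by apply: set_mem; exact: (valP x).
apply/mem_set; split=> [j|].
  by rewrite mxE; case: (unlift i j).
rewrite (bigD1_ord i)//= mxE unlift_none add0r -[RHS]x1.
by apply: eq_bigr => k _; rewrite mxE liftK.
Qed.

Definition face_fun (p : nat) (i : 'I_p.+2) (x : simplex p) : simplex p.+1 :=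
  exist _ (face_row i x) (face_rowP i x).

Lemma face_fun_continuous p (i : 'I_p.+2) : continuous (@face_fun p i).
Proof.
apply: continuous_to_set; apply: continuous_mx => a j /=.
rewrite (_ : (fun x => _) = fun x : simplex p =>
  if unlift i j is Some k then set_val x ord0 k else 0); last first.
  by apply/funext => x; rewrite mxE.
case: (unlift i j) => [k|]; last exact: cst_continuous.
move=> x; apply: (@continuous_comp _ _ _ set_val
  (fun M : 'rV[R]_p.+1 => M ord0 k)).
  exact: set_val_continuous.
exact: coord_continuous.
Qed.

Definition face (p : nat) (i : 'I_p.+2) :
    continuousType (simplex p) (simplex p.+1) :=
  mkcts (@face_fun_continuous p i).

Definition edge_param_fun (x : simplex 1) : R := set_val x ord0 ord_max.

Lemma edge_param_continuous : continuous edge_param_fun.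
Proof.
move=> x; apply: (@continuous_comp _ _ _ set_val
  (fun M : 'rV[R]_2 => M ord0 ord_max)).
  exact: set_val_continuous.
exact: coord_continuous.
Qed.

(* the homeomorphism (1 - t, t) |-> t from the 1-simplex to [0, 1] *)
Definition edge_param : continuousType (simplex 1) R :=
  mkcts edge_param_continuous.

End Simplices.

Section Cohomology.
Context (R : realType) (X : topologicalType).

Definition singular (p : nat) := continuousType (simplex R p) X.

Definition sface (p : nat) (i : 'I_p.+2) (s : singular p.+1) : singular p :=
  s \o face R i.

Definition cochain (p : nat) : zmodType := singular p -> int.

Definition coboundary (p : nat) (c : cochain p) : cochain p.+1 :=
  fun s => \sum_(i < p.+2) (-1) ^+ i * c (sface i s).

Lemma coboundaryB p (c c' : cochain p) :
  coboundary (c - c') = coboundary c - coboundary c'.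
Proof.
apply/funext => s; transitivity (coboundary c s - coboundary c' s) => //.
by rewrite /coboundary -sumrB; apply: eq_bigr => i _; rewrite -mulrBr.
Qed.

Lemma coboundary0 p : coboundary (0 : cochain p) = 0.
Proof. by rewrite -[X in coboundary X](subrr 0) coboundaryB subrr. Qed.

Definition is_cocycle : {pred cochain 1} := fun c => `[< coboundary c = 0 >].

Lemma is_cocycle_zmod : zmod_closed is_cocycle.
Proof.
split=> [|c c' /asboolP dc /asboolP dc']; apply/asboolP.
  exact: coboundary0.
by rewrite coboundaryB dc dc' subrr.
Qed.

HB.instance Definition _ :=
  GRing.isZmodClosed.Build (cochain 1) is_cocycle is_cocycle_zmod.

Record cocycle := Cocycle {
  cocycle_val : cochain 1 ;
  _ : cocycle_val \in is_cocycle }.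

HB.instance Definition _ := [isSub for cocycle_val].
HB.instance Definition _ := [Choice of cocycle by <:].
HB.instance Definition _ := [SubChoice_isSubZmodule of cocycle by <:].

Definition is_coboundary : {pred cocycle} :=
  fun c => `[< exists b : cochain 0, val c = coboundary b >].

Lemma is_coboundary_zmod : zmod_closed is_coboundary.
Proof.
split=> [|c c' /asboolP[b cb] /asboolP[b' cb']]; apply/asboolP.
  by exists 0; rewrite coboundary0.
by exists (b - b'); rewrite coboundaryB -cb -cb'.
Qed.

HB.instance Definition _ :=
  GRing.isZmodClosed.Build cocycle is_coboundary is_coboundary_zmod.

Definition H1 : zmodType := Quotient.quot is_coboundary.

End Cohomology.

Section Pullback.
Context (R : realType) (X Y : topologicalType) (f : continuousType X Y).

Definition cochain_pullback (p : nat) (c : cochain R Y p) : cochain R X p :=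
  fun s => c (f \o s).

Lemma coboundary_pullback p (c : cochain R Y p) :
  coboundary (cochain_pullback c) = cochain_pullback (coboundary c).
Proof.
apply/funext => s; apply: eq_bigr => i _; congr (_ * c _).
exact/continuousEP.
Qed.

Lemma cocycle_pullbackP (c : cocycle R Y) :
  cochain_pullback (val c) \in @is_cocycle R X.
Proof.
apply/asboolP; rewrite coboundary_pullback.
by have /asboolP -> := valP c.
Qed.

Definition cocycle_pullback (c : cocycle R Y) : cocycle R X :=
  Cocycle (cocycle_pullbackP c).

Definition pullback (alpha : H1 R Y) : H1 R X :=
  \pi_(H1 R X) (cocycle_pullback (repr alpha)).

End Pullback.

(* loops S^1 = R/Z -> X *)
Record loop (R : realType) (X : topologicalType) := Loop {
  loop_map :> continuousType R X ;
  loop_periodic : forall t : R, loop_map (t + 1) = loop_map t }.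

(* <alpha, [gamma]>: the restriction of gamma to [0, 1] is a singular 1-cycle
   representing the image of the fundamental class of R/Z *)
Definition pairing (R : realType) (X : topologicalType)
    (alpha : H1 R X) (gamma : loop R X) : int :=
  val (repr alpha) (loop_map gamma \o edge_param R).

Section Circle.
Context (R : realType).

Definition circle : set (R * R) := [set z | z.1 ^+ 2 + z.2 ^+ 2 = 1].

Definition circle_exp_pair (t : R) : R * R :=
  (cos (t * (pi *+ 2)), sin (t * (pi *+ 2))).

Lemma circle_exp_pairP (t : R) : circle_exp_pair t \in circle.
Proof. by apply/mem_set; exact: cos2Dsin2. Qed.

Definition circle_exp_fun (t : R) : set_type circle :=
  exist _ (circle_exp_pair t) (circle_exp_pairP t).

Lemma circle_exp_continuous : continuous circle_exp_fun.
Proof.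
apply: continuous_to_set => t.
have ct : {for t, continuous (fun t : R => t * (pi *+ 2))}.
  exact: mulrr_continuous.
have cc : cos (s * (pi *+ 2)) @[s --> t] --> cos (t * (pi *+ 2)).
  exact: (continuous_comp ct (@continuous_cos R _)).
have cs : sin (s * (pi *+ 2)) @[s --> t] --> sin (t * (pi *+ 2)).
  exact: (continuous_comp ct (@continuous_sin R _)).
exact: (cvg_pair cc cs).
Qed.

Lemma circle_exp_periodic (t : R) : circle_exp_fun (t + 1) = circle_exp_fun t.
Proof.
apply/val_inj; rewrite /= /circle_exp_pair mulrDl mul1r.
by rewrite cosD2pi sinD2pi.
Qed.

Definition circle_loop : loop R (set_type circle) :=
  @Loop R _ (mkcts circle_exp_continuous) circle_exp_periodic.

End Circle.
Arguments circle : clear implicits.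

Definition infinite_order (V : zmodType) (x : V) : Prop :=
  forall k : nat, (0 < k)%N -> x *+ k != 0.

Section Smooth.
Context (R : realType).

Fixpoint Ck (V W : normedModType R) (m : nat) (U : set V)
    (f : V -> W) : Prop :=
  match m with
  | 0 => forall x, U x -> {for x, continuous f}
  | m'.+1 => (forall x, U x -> differentiable f x) /\
             (forall v : V, Ck m' U (fun x => 'd f x v))
  end.

(* meaningful for U open; in finite dimension this is the usual notion of a map
   of class C^m for all m *)
Definition smooth_on (V W : normedModType R) (U : set V) (f : V -> W) : Prop :=
  forall m, Ck m U f.

(* a k-dimensional embedded submanifold of a Euclidean space is a subset each
   point of which has a relatively open neighbourhood diffeomorphic to an open
   subset of R^k; maps from non-open sets are smooth when they extend smoothly *)
Definition smooth_submanifold (E : normedModType R) (k : nat) (M : set E) : Prop :=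
  forall x, M x ->
  exists (U : set E) (O : set 'rV[R]_k) (phi : 'rV[R]_k -> E) (chi : E -> 'rV[R]_k),
    [/\ open U /\ U x, open O, smooth_on O phi, smooth_on U chi &
        phi @` O = M `&` U /\ (forall y, O y -> chi (phi y) = y)].

(* velocities of the smooth curves through x that stay in Z; for a submanifold Z
   this is its tangent space at x *)
Definition tangent (E : normedModType R) (Z : set E) (x : E) : set E :=
  [set v | exists c : R -> E,
     [/\ smooth_on setT c, \forall t \near 0, Z (c t), c 0 = x & derive1 c 0 = v]].

End Smooth.

(* The subspaces of R^d are row spaces of matrices, and Gr_n(R^2n) is embedded
   in the space of matrices by sending W to the orthogonal projection onto W;
   its topology and smooth structure are those of this submanifold *)
Section Grassmannian.
Context (R : realType) (n : nat).
Local Notation E := 'M[R]_(n + n).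

Definition Gr : set E :=
  [set W | [/\ W^T = W, W *m W = W & \rank W = n]].

Definition train (P : E) : set E := [set W | Gr W /\ (W :&: P)%MS != 0].

Definition train1 (P : E) : set E := [set W | Gr W /\ \rank (W :&: P)%MS = 1%N].

Section Loops.
Context (M : set E).

Definition ambient (gamma : loop R (set_type M)) (t : R) : E :=
  set_val (gamma t).

Definition velocity (gamma : loop R (set_type M)) (t : R) : E :=
  derive1 (ambient gamma) t.

Definition sufficiently_generic (P : E) (gamma : loop R (set_type M)) : Prop :=
  [/\ smooth_on setT (ambient gamma),
      forall t, train P (ambient gamma t) -> train1 P (ambient gamma t) &
      forall t, train1 P (ambient gamma t) ->
        ~ tangent (train1 P) (ambient gamma t) (velocity gamma t)].

(* pairs (W, v) with v in T_W Gr representing a nonzero normal vector to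
   train1 P at W *)
Definition normal_vectors (P : E) : set (E * E) :=
  [set Wv | [/\ (train1 P `&` M) Wv.1, tangent Gr Wv.1 Wv.2 &
                ~ tangent (train1 P) Wv.1 Wv.2]].

(* An orientation of the line bundle nu = T Gr / T (train1 P) over train1 P `&` M
   is given by the continuous choice of the nonzero vectors of nu that are
   positive, i.e., on which o is true *)
Definition coorientation (P : E) (o : E * E -> bool) : Prop :=
  {within normal_vectors P, continuous o} /\
  forall W v z (a : R), normal_vectors P (W, v) -> tangent (train1 P) W z ->
    a != 0 -> o (W, a *: v + z) = if 0 < a then o (W, v) else ~~ o (W, v).

Definition crossing_sign (o : E * E -> bool) (gamma : loop R (set_type M))
    (t : R) : int :=
  if o (ambient gamma t, velocity gamma t) then 1 else -1.

(* S^1 is parametrized once by [0, 1[; the sum over a set is the one of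
   fsbigop, which makes sense since a sufficiently generic loop meets the train
   finitely many times *)
Definition intersection_number (P : E) (o : E * E -> bool)
    (gamma : loop R (set_type M)) : int :=
  \sum_(t \in [set t : R | 0 <= t < 1 /\ train P (ambient gamma t)])
    crossing_sign o gamma t.

End Loops.

Record MA_triple := MATriple {
  MA_set : set E ;
  MA_ref : E ;
  MA_class : H1 R (set_type MA_set) }.

Definition is_MA_space (T : MA_triple) : Prop :=
  [/\ MA_set T `<=` Gr, Gr (MA_ref T), infinite_order (MA_class T) &
      exists2 o, coorientation (MA_set T) (MA_ref T) o &
      forall gamma : loop R (set_type (MA_set T)),
        sufficiently_generic (MA_ref T) gamma ->
        intersection_number (MA_ref T) o gamma = pairing (MA_class T) gamma].

Definition extends (T2 T1 : MA_triple) : Prop :=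
  exists s12 : MA_set T1 `<=` MA_set T2,
    MA_ref T1 = MA_ref T2 /\ pullback (incl s12) (MA_class T2) = MA_class T1.

Definition proper_extension (T2 T1 : MA_triple) : Prop :=
  extends T2 T1 /\ MA_set T1 <> MA_set T2.

(* Omega is the Gram matrix of the form (u, v) |-> u *m Omega *m v^T *)
Definition symplectic (Omega : E) : Prop :=
  Omega^T = - Omega /\ Omega \in unitmx.

Definition Lagrangian (Omega : E) : set E :=
  [set W | Gr W /\ W *m Omega *m W^T = 0].

(* the rows e_1, .., e_n, f_1, .., f_n of S satisfy
   omega(e_i, f_j) = (i == j) and omega(e_i, e_j) = omega(f_i, f_j) = 0 *)
Definition symplectic_basis (Omega S : E) : Prop :=
  S *m Omega *m S^T = block_mx 0 1%:M (- 1%:M) 0.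

Definition complex_mx (X Y : 'M[R]_n) : 'M[R[i]]_n :=
  \matrix_(i, j) Complex (X i j) (Y i j).

(* rho is the map Det^2 : Lambda(n) = U(n)/O(n) -> S^1 for the identification of
   R^2n with C^n sending e_j to the j-th basis vector and f_j to i times it; the
   frame (X, Y) of W needs not be unitary, whence the factor |d|^2 *)
Definition is_det2 (Omega S : E)
    (rho : set_type (Lagrangian Omega) -> set_type (circle R)) : Prop :=
  forall (W : set_type (Lagrangian Omega)) (X Y : 'M[R]_n),
    (row_mx X Y *m S == set_val W)%MS ->
    let d := \det (complex_mx X Y) in
    d ^+ 2 = `|d| ^+ 2 * Complex (set_val (rho W)).1 (set_val (rho W)).2.

(* tau is the generator of H^1(S^1; Z) dual to the positively oriented circle *)
Definition is_Maslov_class (Omega : E)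
    (alpha0 : H1 R (set_type (Lagrangian Omega))) : Prop :=
  exists (S : E) (rho : continuousType (set_type (Lagrangian Omega))
                                       (set_type (circle R)))
         (tau : H1 R (set_type (circle R))),
    [/\ symplectic_basis Omega S, is_det2 S rho,
        pairing tau (circle_loop R) = 1 & alpha0 = pullback rho tau].

Definition classical_MA (Omega P : E)
    (alpha0 : H1 R (set_type (Lagrangian Omega))) : MA_triple :=
  MATriple P alpha0.

End Grassmannian.

(* Main.v *)
(* In a Darboux frame (F, G) of a Lagrangian subspace W, nearby subspaces are the
   graphs of n x n matrices X; the Lagrangian ones are those with X symmetric,
   and when W = P the train of P is det X = 0. Suppose that M is larger than
   Lambda(n). Then T_P M is larger than the space of symmetric matrices:
   otherwise T_W M = T_W Lambda(n) for every Lagrangian W, by a dimension count,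
   so that the skew part of X has zero derivative along M at W, Lambda(n) is open
   and closed in M, and M = Lambda(n). A nonzero skew matrix in T_P M makes the
   train of P in M non-coorientable, so that no class alpha is needed to reach a
   contradiction. Indeed the normal line of the train at W is
   Hom(W :&: P, R^2n / (W + P)), and diag(e, 0, e, .., e) is joined to
   diag(-e, 0, e, .., e) by two paths of corank one in M: one near P, along which
   the line W :&: P makes a half turn and R^2n / (W + P) does not, and one through
   infinity in Lambda(n), along which both are constant. Transporting a normal
   vector along them gives opposite results. *)
From HB Require Import structures.
Require Import Defs.
From mathcomp Require Import all_boot all_order all_algebra.
From mathcomp Require Import perm ring lra.
From mathcomp Require Import all_classical all_reals all_analysis.

Set Implicit Arguments.
Unset Strict Implicit.
Unset Printing Implicit Defensive.

Import Order.TTheory GRing.Theory Num.Theory.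
Import numFieldNormedType.Exports.

Local Open Scope classical_set_scope.
Local Open Scope ring_scope.

(** The obstacle is that a tangent matrix of M is only infinitesimal: the explicit family of corank
    one matrices through a nonsymmetric direction does not consist of points of M. The family is
    therefore scaled into a small neighbourhood of P and pushed into M by a local retraction; the
    equation det = 0, lost on the way, is restored by an extra parameter [y] that moves along
    symmetric directions. Both this correction and the comparison of M with Lambda(n) estimate
    differences at two arbitrary nearby points, hence the use of strict derivatives, which stand in
    for the inverse and implicit function theorems. The skew direction matters only modulo symmetric
    matrices, which are all tangent to M; its strictly lower triangular representative makes the
    determinant of the family explicit in every rank. To make the two transports comparable, a
    normal vector is built from a matrix S by a formula, [nfield], that depends on the subspace and
    not on a frame of it: near P, S passes from a diagonal matrix unit to its opposite, and through
    infinity S is constant. *)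

Section MatrixTopology.
Context {R : realType}.

Lemma le_mx_norm m n (M : 'M[R]_(m, n)) i j : `|M i j| <= `|M|.
Proof.
rewrite [leRHS]/Num.Def.normr /= mx_normrE.
exact: (le_bigmax _ (fun ij : 'I_m * 'I_n => `|M ij.1 ij.2|) (i, j)).
Qed.

Lemma mx_norm_le m n (M : 'M[R]_(m, n)) (e : R) :
  0 <= e -> (forall i j, `|M i j| <= e) -> `|M| <= e.
Proof.
move=> e0 Me; rewrite /Num.Def.normr /= mx_normrE.
by apply/bigmax_leP; split=> // -[i j] _.
Qed.

Lemma norm_trmx m n (M : 'M[R]_(m, n)) : `|M^T| = `|M|.
Proof.
have le p q (N : 'M[R]_(p, q)) : `|N^T| <= `|N|.
  by apply: mx_norm_le => // i j; rewrite mxE le_mx_norm.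
by apply/eqP; rewrite eq_le le -{1}[M]trmxK le.
Qed.

Lemma norm_mulmx_le m n p (A : 'M[R]_(m, n)) (B : 'M[R]_(n, p)) :
  `|A *m B| <= n%:R * `|A| * `|B|.
Proof.
apply: mx_norm_le => [|i j]; first by rewrite !mulr_ge0.
rewrite mxE (le_trans (ler_norm_sum _ _ _))// -mulrA.
apply: le_trans (_ : \sum_(k < n) `|A| * `|B| <= _).
  by apply: ler_sum => k _; rewrite normrM ler_pM// le_mx_norm.
by rewrite sumr_const card_ord mulr_natl.
Qed.

(** * Limits of matrix operations along an arbitrary filter *)

Section Cvg.
Context {T : Type} {F : set_system T} {FF : Filter F}.

Lemma cvg_mx m n (f : T -> 'M[R]_(m, n)) (l : 'M[R]_(m, n)) :
  (forall i j, f x i j @[x --> F] --> l i j) -> f @ F --> l.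
Proof.
move=> fl A [P nP PA]; apply: (@filterS _ F _ _ _ (fun y => PA (f y))).
by apply: filter_forall => i; apply: filter_forall => j; apply: fl; exact: nP.
Qed.

Lemma cvg_mx_coord m n (f : T -> 'M[R]_(m, n)) (l : 'M[R]_(m, n)) i j :
  f @ F --> l -> f x i j @[x --> F] --> l i j.
Proof. move=> fl; apply: (@cvg_comp _ _ _ f (fun M : 'M[R]_(m, n) => M i j)).
  exact: fl.
exact: coord_continuous. Qed.

Lemma cvg_trmx m n (f : T -> 'M[R]_(m, n)) (l : 'M[R]_(m, n)) :
  f @ F --> l -> (f x)^T @[x --> F] --> l^T.
Proof.
move=> fl; apply: cvg_mx => i j; rewrite mxE.
under eq_fun do rewrite mxE.
exact: cvg_mx_coord.
Qed.

Lemma cvg_sumr I (r : seq I) (f : I -> T -> R) (l : I -> R) :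
  (forall i, f i @ F --> l i) ->
  \sum_(i <- r) f i x @[x --> F] --> \sum_(i <- r) l i.
Proof.
move=> fl; elim: r => [|i r IH].
  by under eq_fun do rewrite big_nil; rewrite big_nil; exact: cvg_cst.
under eq_fun do rewrite big_cons; rewrite big_cons.
exact: cvgD.
Qed.

Lemma cvg_prodr I (r : seq I) (f : I -> T -> R) (l : I -> R) :
  (forall i, f i @ F --> l i) ->
  \prod_(i <- r) f i x @[x --> F] --> \prod_(i <- r) l i.
Proof.
move=> fl; elim: r => [|i r IH].
  by under eq_fun do rewrite big_nil; rewrite big_nil; exact: cvg_cst.
under eq_fun do rewrite big_cons; rewrite big_cons.
exact: cvgM.
Qed.

Lemma cvg_mulmx m n p (f : T -> 'M[R]_(m, n)) (g : T -> 'M[R]_(n, p))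
    (A : 'M[R]_(m, n)) (B : 'M[R]_(n, p)) :
  f @ F --> A -> g @ F --> B -> (f x *m g x) @[x --> F] --> A *m B.
Proof.
move=> fA gB; apply: cvg_mx => i j; rewrite mxE.
under eq_fun do rewrite mxE.
by apply: cvg_sumr => k; apply: cvgM; exact: cvg_mx_coord.
Qed.

Lemma cvg_det n (f : T -> 'M[R]_n) (A : 'M[R]_n) :
  f @ F --> A -> \det (f x) @[x --> F] --> \det A.
Proof.
move=> fA; apply: cvg_sumr => s; apply: cvgM; first exact: cvg_cst.
by apply: cvg_prodr => i; exact: cvg_mx_coord.
Qed.

Lemma cvg_adj n (f : T -> 'M[R]_n) (A : 'M[R]_n) :
  f @ F --> A -> \adj (f x) @[x --> F] --> \adj A.
Proof.
move=> fA; apply: cvg_mx => i j; rewrite mxE.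
under eq_fun do rewrite mxE.
apply: cvgM; first exact: cvg_cst.
apply: cvg_det; apply: cvg_mx => k l; rewrite !mxE.
under eq_fun do rewrite !mxE.
exact: cvg_mx_coord.
Qed.

Lemma cvg_mxtrace n (f : T -> 'M[R]_n) (A : 'M[R]_n) :
  f @ F --> A -> \tr (f x) @[x --> F] --> \tr A.
Proof. by move=> fA; apply: cvg_sumr => i; exact: cvg_mx_coord. Qed.

Lemma near_unitmx n (f : T -> 'M[R]_n) (A : 'M[R]_n) :
  f @ F --> A -> A \in unitmx -> \forall x \near F, f x \in unitmx.
Proof.
move=> fA; rewrite unitmxE unitfE => A0.
have := cvg_det fA => /cvgr_neq0 => /(_ A0).
by apply: filterS => x fx; rewrite unitmxE unitfE.
Qed.

Lemma cvg_invmx n (f : T -> 'M[R]_n) (A : 'M[R]_n) :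
  f @ F --> A -> A \in unitmx -> invmx (f x) @[x --> F] --> invmx A.
Proof.
move=> fA Au; have fu := near_unitmx fA Au.
rewrite {2}/invmx Au.
have : (\det (f x))^-1 *: \adj (f x) @[x --> F] --> (\det A)^-1 *: \adj A.
  apply: cvgZ; last exact: cvg_adj.
  by apply: cvgV; [move: Au; rewrite unitmxE unitfE|exact: cvg_det].
apply: cvg_trans; apply: near_eq_cvg; apply: filterS fu => x fx.
by rewrite /invmx fx.
Qed.

End Cvg.

Lemma cvg_near0_norm (V : normedModType R) (A : set V) :
  (\forall x \near 0, A x) -> exists2 r : R, 0 < r & forall x, `|x| < r -> A x.
Proof.
move=> /nbhs_ballP[r r0 rA]; exists r => // x xr; apply: rA.
by rewrite -ball_normE /= sub0r normrN.
Qed.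

End MatrixTopology.

Lemma mx_cvg_unique (R : realType) T (F : set_system T) (FF : ProperFilter F)
    m n (f : T -> 'M[R]_(m, n)) (l l' : 'M[R]_(m, n)) :
  f @ F --> l -> f @ F --> l' -> l = l'.
Proof.
move=> fl fl'; apply/matrixP => i j.
have h := @cvg_mx_coord _ _ _ _ _ f l i j fl.
have h' := @cvg_mx_coord _ _ _ _ _ f l' i j fl'.
exact: cvg_unique h h'.
Qed.

Lemma cvg_line (R : realType) (V : normedModType R) (x v : V) :
  x + t *: v @[t --> (0 : R)^'] --> x.
Proof.
have {2}-> : x = x + 0 *: v by rewrite scale0r addr0.
apply: cvg_within_filter.
refine (@cvgD R _ _ _ _ (fun _ : R => x) (fun t : R => t *: v) _ _ _ _).
  exact: cvg_cst.
by apply: cvgZr_tmp; exact: cvg_id.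
Qed.

(** * Jacobi's formula and a mean value theorem for determinants *)

Section Jacobi.
Context {R : realType}.

(** With [uniq r] the test [i == k] singles out one factor. In this conditional form the derivative
    of a determinant reads as a sum of determinants with one row replaced. *)
Lemma is_derive_prod (I : eqType) (r : seq I) (f : I -> R -> R) (df : I -> R)
    (t : R) : uniq r -> (forall i, is_derive t 1 (f i) (df i)) ->
  is_derive t 1 (fun x => \prod_(i <- r) f i x)
    (\sum_(k <- r) \prod_(i <- r) (if i == k then df i else f i t)).
Proof.
move=> + fdf; elim: r => [|j r IH] /=.
  rewrite big_nil; under eq_fun do rewrite big_nil.
  by move=> _; exact: is_derive_cst.
move=> /andP[jr ur]; under eq_fun do rewrite big_cons.
apply: (is_derive_eq (is_deriveM (fdf j) (IH ur))).
rewrite big_cons big_cons eqxx addrC; congr (_ + _).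
  rewrite mulrC -[LHS]/(_ * _); congr (_ * _).
  apply: eq_big_seq => i ir; case: eqP => // ij.
  by move: jr; rewrite -ij ir.
rewrite -[LHS]/(_ * _) mulr_sumr; apply: eq_big_seq => k kr.
by rewrite big_cons; case: eqP => // jk; move: jr; rewrite jk kr.
Qed.

Lemma is_derive_sumr (I : Type) (r : seq I) (f : I -> R -> R) (df : I -> R)
    (t : R) : (forall i, is_derive t 1 (f i) (df i)) ->
  is_derive t 1 (fun x => \sum_(i <- r) f i x) (\sum_(i <- r) df i).
Proof.
move=> fdf; elim: r => [|j r IH].
  rewrite big_nil; under eq_fun do rewrite big_nil.
  exact: is_derive_cst.
by under eq_fun do rewrite big_cons; rewrite big_cons; exact: is_deriveD.
Qed.

Lemma is_derive_det n (K : R -> 'M[R]_n) (dK : 'M[R]_n) (t : R) :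
  (forall i j, is_derive t 1 (fun x => K x i j) (dK i j)) ->
  is_derive t 1 (fun x => \det (K x)) (\tr (\adj (K t) *m dK)).
Proof.
move=> KdK; rewrite /determinant.
(* [Kk k] is [K t] with its row [k] differentiated; expanding its determinant along that row
   produces the cofactors of [K t], that is, a diagonal entry of the trace. *)
pose Kk k := \matrix_(i, j) (if i == k then dK i j else K t i j).
suff H : is_derive t 1 (fun x => \det (K x)) (\sum_k \det (Kk k)).
  apply: (is_derive_eq H).
  rewrite -mxtrace_mulC; apply: eq_bigr => k _.
  rewrite mxE (expand_det_row _ k); apply: eq_bigr => j _.
  rewrite !mxE eqxx; congr (_ * (_ * \det _)).
  by apply/matrixP => a b; rewrite !mxE eq_sym (negPf (neq_lift _ _)).
rewrite /determinant exchange_big /=; apply: is_derive_sumr => s.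
have D := is_deriveM (@is_derive_cst _ _ _ ((-1) ^+ s : R) t 1)
  (is_derive_prod (index_enum_uniq 'I_n) (fun i => KdK i (s i))).
apply: (is_derive_eq D).
rewrite scaler0 addr0 -[LHS]/(_ * _) mulr_sumr.
apply: eq_bigr => k _; congr (_ * _); apply: eq_bigr => i _.
by rewrite mxE.
Qed.

Lemma is_derive_det_line n (A B : 'M[R]_n) (t : R) :
  is_derive t 1 (fun c : R => \det (A + c *: B)) (\tr (\adj (A + t *: B) *m B)).
Proof.
apply: is_derive_det => i j.
rewrite (_ : (fun x => _) = fun x : R => A i j + B i j *: x).
  have D := is_deriveD (@is_derive_cst _ _ _ (A i j) t 1)
    (is_deriveZ (B i j) (@is_derive_id _ _ t 1)).
  by apply: (is_derive_eq D); rewrite add0r /GRing.scale /= mulr1.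
by apply/funext => x; rewrite [LHS]mxE [X in _ + X = _]mxE /GRing.scale /= mulrC.
Qed.

Lemma det_MVT n (A B : 'M[R]_n) : exists2 c : R, 0 <= c <= 1 &
  \det B - \det A = \tr (\adj (A + c *: (B - A)) *m (B - A)).
Proof.
have dK := is_derive_det_line A (B - A).
have [c c01] := @MVT_segment R _ _ 0 1 ler01 (fun x _ => dK x)
  (continuous_subspaceT (fun x => differentiable_continuous
     ((derivable1_diffP _ _).1 (@ex_derive _ _ _ _ _ _ _ (dK x))))).
rewrite scale0r scale1r addr0 subr0 mulr1 addrCA subrr addr0 => ->.
by exists c.
Qed.

End Jacobi.

Lemma is_derive_div (R : realType) (f g : R -> R) (t df dg : R) :
  g t != 0 -> is_derive t 1 f df -> is_derive t 1 g dg ->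
  is_derive t 1 (fun x => f x / g x) ((df * g t - f t * dg) / (g t) ^+ 2).
Proof.
move=> g0 Df Dg.
have df1 : derivable f t 1 by exact: (@ex_derive _ _ _ _ _ _ _ Df).
have dg1 : derivable g t 1 by exact: (@ex_derive _ _ _ _ _ _ _ Dg).
have dv : derivable (fun x => (g x)^-1) t 1 by exact: derivableV.
have D := is_deriveM (derivableP df1) (derivableP dv).
apply: (is_derive_eq D); rewrite deriveV// !derive_val /GRing.scale /=.
by field.
Qed.

(** * Rational matrix curves and their smoothness *)

Section RationalCurves.
Context {R : realType} (q : {poly R}) (q0 : forall t, q.[t] != 0).

(** The exponent [k] is kept apart so that these curves form a class stable under differentiation
    with a fixed [q]; smoothness of every order is then a plain induction. *)
Definition ratcurve m n k (p : 'M[{poly R}]_(m, n)) (t : R) : 'M[R]_(m, n) :=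
  (q.[t] ^+ k)^-1 *: map_mx (horner^~ t) p.

(* (p / q^k)' = (p' q - k q' p) / q^(k+1) *)
Definition ratderiv m n k (p : 'M[{poly R}]_(m, n)) : 'M[{poly R}]_(m, n) :=
  \matrix_(i, j) ((p i j)^`() * q - (q^`() * p i j) *+ k).

Lemma ratcurve_derive m n k (p : 'M[{poly R}]_(m, n)) (t : R) :
  is_derive t 1 (ratcurve k p) (ratcurve k.+1 (ratderiv k p) t).
Proof.
have D i j : is_derive t 1 (fun x => ratcurve k p x i j)
    (ratcurve k.+1 (ratderiv k p) t i j).
  rewrite (_ : (fun x => _) =
      (fun x : R => (p i j).[x] / (q ^+ k).[x])); last first.
    by apply/funext => x; rewrite !mxE mulrC horner_exp.
  have qk0 : (q ^+ k).[t] != 0 by rewrite horner_exp expf_neq0.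
  apply: (is_derive_eq (is_derive_div qk0 (is_derive_poly (p i j) t)
    (is_derive_poly (q ^+ k) t))).
  rewrite !mxE deriv_exp !(hornerMn, hornerE, horner_exp).
  rewrite -![(_ * _) *+ k]mulr_natl.
  have q1 := q0 t.
  case: k {qk0} => [|k] /=; rewrite ?exprS ?expr0; field => //.
  by rewrite expf_neq0.
split; first by apply/derivable_mxP => i j; exact: ex_derive.
rewrite derive_mx; last by apply/derivable_mxP => i j; exact: ex_derive.
by apply/matrixP => i j; rewrite mxE derive_val.
Qed.

Lemma ratcurve_smooth m n k (p : 'M[{poly R}]_(m, n)) :
  smooth_on setT (ratcurve k p).
Proof.
move=> d; elim: d k p => [|d IH] k p /=.
  move=> x _; apply/differentiable_continuous/derivable1_diffP.
  exact: (@ex_derive _ _ _ _ _ _ _ (ratcurve_derive k p x)).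
have dr x : derivable (ratcurve k p) x 1.
  exact: (@ex_derive _ _ _ _ _ _ _ (ratcurve_derive k p x)).
split=> [x _|v]; first exact/derivable1_diffP.
rewrite (_ : (fun x => _) =
   ratcurve k.+1 (\matrix_(i, j) (v *: ratderiv k p i j))); first exact: IH.
apply/funext => x; rewrite deriv1E// derive1E.
rewrite (@derive_val _ _ _ _ _ _ _ (ratcurve_derive k p x)).
by apply/matrixP => i j; rewrite !mxE hornerZ mulrCA.
Qed.

End RationalCurves.

(** * Orthogonal projectors as functions of frames *)

Section Projection.
Context {R : realType}.

Lemma mulmx_trmx_eq0 m n (A : 'M[R]_(m, n)) : A *m A^T = 0 -> A = 0.
Proof.
move=> A0; apply/matrixP => i j; rewrite mxE.
have /matrixP/(_ i i) := A0; rewrite !mxE => /eqP.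
rewrite psumr_eq0 => [/allP/(_ j)|k _]; last by rewrite mxE -expr2 sqr_ge0.
by rewrite mem_index_enum mxE mulf_eq0 orbb => /(_ isT)/eqP.
Qed.

(** For [H] of full row rank this is the Moore-Penrose inverse, a right inverse of [H], so that
    [proj H] is the orthogonal projector that represents the row space of [H] in [Gr]. *)
Definition lpinv m n (H : 'M[R]_(m, n)) : 'M[R]_(n, m) :=
  H^T *m invmx (H *m H^T).

Definition proj m n (H : 'M[R]_(m, n)) : 'M[R]_n := lpinv H *m H.

Lemma gram_unit m n (H : 'M[R]_(m, n)) : row_free H -> H *m H^T \in unitmx.
Proof.
move=> Hf; rewrite -row_free_unit; apply: inj_row_free => u uHH.
have /mulmx_trmx_eq0 uH : (u *m H) *m (u *m H)^T = 0.
  by rewrite trmx_mul mulmxA -(mulmxA u) uHH mul0mx.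
by apply: (row_free_inj Hf); rewrite uH mul0mx.
Qed.

Section ProjTheory.
Context m n (H : 'M[R]_(m, n)) (Hf : row_free H).

Lemma mul_lpinv : H *m lpinv H = 1%:M.
Proof. by rewrite mulmxA mulmxV// gram_unit. Qed.

Lemma mul_proj : H *m proj H = H.
Proof. by rewrite mulmxA mul_lpinv mul1mx. Qed.

Lemma proj_sym : (proj H)^T = proj H.
Proof. by rewrite !trmx_mul trmx_inv trmx_mul trmxK mulmxA. Qed.

Lemma proj_idem : proj H *m proj H = proj H.
Proof. by rewrite {1}/proj -mulmxA mul_proj. Qed.

Lemma proj_eqmx : (proj H :=: H)%MS.
Proof.
apply/eqmxP; rewrite submxMl /=.
by apply/submxP; exists H; rewrite mul_proj.
Qed.

(** Idempotents with the same row space absorb each other on the right; transposing one of the two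
    identities makes symmetric ones equal. *)
Lemma proj_uniq (V : 'M[R]_n) :
  V^T = V -> V *m V = V -> (V :=: H)%MS -> V = proj H.
Proof.
move=> Vs Vi VH.
have le1 : V *m proj H = V.
  have /submxP[D ->] : (V <= proj H)%MS by rewrite proj_eqmx VH.
  by rewrite -mulmxA proj_idem.
have le2 : proj H *m V = proj H.
  have /submxP[D ->] : (proj H <= V)%MS by rewrite proj_eqmx VH.
  by rewrite -mulmxA Vi.
by rewrite -le1 -[LHS]trmxK trmx_mul proj_sym Vs le2 proj_sym.
Qed.

Lemma mul_compl_proj : H *m (1%:M - proj H) = 0.
Proof. by rewrite mulmxBr mulmx1 mul_proj subrr. Qed.

End ProjTheory.

(** Being exact at two arbitrary frames, this formula gives derivatives along curves as well as the
    strict derivative of graph charts. Each summand reduces to one projector times the complement of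
    the other, because a frame is annihilated by its own complementary projector. *)
Lemma projB m n (H H' : 'M[R]_(m, n)) : row_free H -> row_free H' ->
  proj H - proj H' =
  lpinv H *m (H - H') *m (1%:M - proj H') +
  (lpinv H' *m (H - H') *m (1%:M - proj H))^T.
Proof.
move=> Hf H'f.
have -> : lpinv H *m (H - H') *m (1%:M - proj H') = proj H *m (1%:M - proj H').
  by rewrite -mulmxA mulmxBl (mul_compl_proj H'f) subr0 mulmxA.
have -> : lpinv H' *m (H - H') *m (1%:M - proj H) =
    - (proj H' *m (1%:M - proj H)).
  by rewrite -mulmxA mulmxBl (mul_compl_proj Hf) sub0r mulmxN mulmxA.
rewrite linearN /= trmx_mul [(1%:M - _)^T]linearB /= trmx1 !proj_sym//.
by rewrite mulmxBr mulmxBl mulmx1 mul1mx opprB subrKA.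
Qed.

Lemma proj_lin m n (g : 'M[R]_m) (H : 'M[R]_(m, n)) :
  g \in unitmx -> row_free H -> proj (g *m H) = proj H.
Proof.
rewrite -row_full_unit => gu Hf; have gH := eqmxMfull H gu.
have gHf : row_free (g *m H) by rewrite /row_free gH.
apply: proj_uniq => //; [exact: proj_sym|exact: proj_idem|].
exact: (eqmx_trans (proj_eqmx gHf) gH).
Qed.

Lemma cvg_lpinv T (F : set_system T) (FF : Filter F) m n
    (f : T -> 'M[R]_(m, n)) (H : 'M[R]_(m, n)) : row_free H ->
  f @ F --> H -> lpinv (f x) @[x --> F] --> lpinv H.
Proof.
move=> Hf fH; apply: cvg_mulmx; first exact: cvg_trmx.
apply: cvg_invmx; last exact: gram_unit.
by apply: cvg_mulmx => //; exact: cvg_trmx.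
Qed.

Lemma cvg_proj T (F : set_system T) (FF : Filter F) m n
    (f : T -> 'M[R]_(m, n)) (H : 'M[R]_(m, n)) : row_free H ->
  f @ F --> H -> proj (f x) @[x --> F] --> proj H.
Proof. by move=> Hf fH; apply: cvg_mulmx => //; exact: cvg_lpinv. Qed.

End Projection.

(** * Corank one and the adjugate *)

Section Rank.
Context {R : realType}.

Lemma rank_row'_le m n (A : 'M[R]_(m, n)) i : (\rank (row' i A) <= \rank A)%N.
Proof.
apply: mxrankS; apply/row_subP => k.
rewrite (_ : row k _ = row (lift i k) A) ?row_sub//.
by apply/rowP => l; rewrite !mxE.
Qed.

(** A nonzero entry of the adjugate is, up to sign, a nonzero minor of size [n - 1]. *)
Lemma rank_adj_neq0 n (B : 'M[R]_n) :
  \det B = 0 -> \adj B != 0 -> (\rank B).+1 = n.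
Proof.
case: n B => [B|n B detB adjB].
  by rewrite det_mx00 => /eqP; rewrite oner_eq0.
apply/eqP; rewrite eqSS eqn_leq; apply/andP; split.
  rewrite -ltnS ltn_neqAle rank_leq_row andbT.
  apply/negP => rB; have : row_free B by [].
  by rewrite row_free_unit unitmxE detB unitr0.
rewrite leqNgt; apply/negP => rB; case/negP: adjB; apply/eqP/matrixP => i j.
rewrite !mxE /cofactor; suff -> : \det (row' j (col' i B)) = 0 by rewrite mulr0.
apply/eqP; rewrite -[_ == 0]negbK -unitfE -unitmxE -row_free_unit.
apply/negP => /eqP rn; move: rB; rewrite ltnNge => /negP; apply.
apply: (@leq_trans (\rank (row' j (col' i B)))); first by rewrite rn.
rewrite (leq_trans (rank_row'_le _ _))// -mxrank_tr tr_col'.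
by rewrite (leq_trans (rank_row'_le _ _))// mxrank_tr.
Qed.

End Rank.

(** * Darboux frames and the train in coordinates *)

Section Frames.
Context {R : realType} {n : nat}.
Local Notation E := 'M[R]_(n + n).
Implicit Types (Omega W V : E) (F G H : 'M[R]_(n, n + n)).

Lemma proj_Gr H : row_free H -> Gr (proj H).
Proof.
move=> Hf; split; [exact: proj_sym|exact: proj_idem|].
by rewrite (proj_eqmx Hf); apply/eqP.
Qed.

Lemma Gr_frame W : Gr W ->
  exists H, [/\ row_free H, (H :=: W)%MS, W = proj H & H *m W = H].
Proof.
case=> Ws Wi rW; have [H [Hf HW]] : exists H, row_free H /\ (H :=: W)%MS.
  move: (row_base W) (row_base_free W) (eq_row_base W); rewrite rW => H Hf HW.
  by exists H.
have WH : W = proj H by apply: proj_uniq => //; exact: eqmx_sym.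
by exists H; split=> //; rewrite WH mul_proj.
Qed.

Lemma Gr_sub_eqmx V H : Gr V -> row_free H -> (H <= V)%MS ->
  V = proj H /\ H *m V = H.
Proof.
case=> Vs Vi rV Hf HV; have VH : V = proj H.
  apply: proj_uniq => //; apply/eqmx_sym/eqmxP.
  by rewrite -(geq_leqif (mxrank_leqif_eq HV)) rV (eqP Hf).
by rewrite VH mul_proj.
Qed.

Record darboux Omega W F G : Prop := Darboux {
  darboux_free : row_free F ;
  darboux_eqmx : (F :=: W)%MS ;
  darbouxFF : F *m Omega *m F^T = 0 ;
  darbouxFG : F *m Omega *m G^T = 1%:M ;
  darbouxGG : G *m Omega *m G^T = 0 }.

Lemma darboux_exists Omega W : symplectic Omega -> Lagrangian Omega W ->
  exists F G, darboux Omega W F G.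
Proof.
move=> [OT Ou] [GrW WOW]; have [F [Ff FW WF FWF]] := Gr_frame GrW.
have [Ws _ _] := GrW.
have FF : F *m Omega *m F^T = 0.
  rewrite -FWF trmx_mul Ws -!mulmxA (mulmxA Omega) (mulmxA W) (mulmxA W).
  by rewrite -{2}Ws WOW mul0mx mulmx0.
have FOf : row_free (F *m Omega).
  by rewrite /row_free mxrankMfree// row_free_unit.
pose G0 := (pinvmx (F *m Omega))^T; pose K := G0 *m Omega *m G0^T.
have FG0 : F *m Omega *m G0^T = 1%:M by rewrite trmxK mulmxVp.
have G0F : G0 *m Omega *m F^T = - 1%:M.
  have := congr1 trmx FG0; rewrite 2!trmx_mul trmxK OT mulNmx mulmxN mulmxA.
  by rewrite trmx1 => <-; rewrite opprK.
have KT : K^T = - K.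
  by rewrite !trmx_mul trmxK OT mulNmx mulmxN mulmxA.
(* [G0] is dual to [F] but has Gram matrix [K]. Subtracting [C *m F] keeps the duality, as [F] is
   isotropic, and changes the Gram matrix by [- 2 C]. *)
pose C := 2^-1 *: K.
have CT : C^T = - C by rewrite linearZ /= KT scalerN.
have GT : (G0 - C *m F)^T = G0^T + F^T *m C.
  by rewrite [LHS]linearB /= trmx_mul CT mulmxN opprK.
exists F, (G0 - C *m F); split=> //.
  by rewrite GT mulmxDr FG0 mulmxA FF mul0mx addr0.
rewrite GT mulmxDr !mulmxBl !mulmxA G0F -/K -(mulmxA C F) -(mulmxA C _ G0^T).
rewrite FG0 -(mulmxA C _ F^T) FF mulmx0 mul0mx subr0 mulmx1 mulNmx mul1mx.
rewrite -addrA -opprD -mulr2n -scaler_nat scalerA mulfV ?pnatr_eq0//.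
by rewrite scale1r subrr.
Qed.

Lemma darbouxGF Omega W F G : symplectic Omega -> darboux Omega W F G ->
  G *m Omega *m F^T = - 1%:M.
Proof.
move=> [OT _] D; have := congr1 trmx (darbouxFG D).
rewrite 2!trmx_mul trmxK OT mulNmx mulmxN mulmxA.
by rewrite trmx1 => <-; rewrite opprK.
Qed.

Lemma darboux_decomp Omega W F G H :
  symplectic Omega -> darboux Omega W F G ->
  H = (H *m Omega *m G^T) *m F - (H *m Omega *m F^T) *m G.
Proof.
move=> Os D; have GF := darbouxGF Os D.
pose S : E := col_mx F G; pose T := G^T *m F - F^T *m G.
have Su : S \in unitmx.
  have : S *m (Omega *m S^T *m block_mx 0 (- 1%:M) 1%:M 0) = 1%:M.
    rewrite !mulmxA mul_col_mx tr_col_mx mul_col_row.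
    rewrite (darbouxFF D) (darbouxFG D) (darbouxGG D) GF mulmx_block.
    rewrite !mulmx0 !mul0mx !mulmx1 !mulmxN !mulmx1 opprK ?oppr0.
    by rewrite !add0r !addr0 -scalar_mx_block.
  by case/mulmx1_unit.
have ST : S *m (Omega *m T) = S.
  rewrite mulmxA mul_col_mx mul_col_mx /T !mulmxBr !mulmxA.
  rewrite (darbouxFF D) (darbouxFG D) (darbouxGG D) GF.
  by rewrite !mul0mx !mulNmx !mul1mx subr0 sub0r opprK.
have OT : Omega *m T = 1%:M.
  by rewrite -[LHS](mulKmx Su) ST mulVmx.
by rewrite -{1}[H]mulmx1 -OT /T !mulmxBr !mulmxA.
Qed.

(** A Lagrangian subspace is its own symplectic complement, so [W] is the kernel of [Omega *m F^T]
    and the formula is rank-nullity on [V]. It turns the train into the equation det = 0, with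
    corank the dimension of the intersection. *)
Lemma rank_cap_frame Omega W F G V H :
  symplectic Omega -> darboux Omega W F G -> row_free H -> (H :=: V)%MS ->
  (\rank (H *m Omega *m F^T) + \rank (V :&: W)%MS)%N = n.
Proof.
move=> Os D Hf HV.
have Wk : (kermx (Omega *m F^T) :=: W)%MS.
  apply/eqmx_sym/eqmxP; rewrite -(geq_leqif (mxrank_leqif_eq _)).
    rewrite mxrank_ker -(darboux_eqmx D) (eqP (darboux_free D)).
    rewrite -mxrank_tr trmx_mul trmxK mxrankMfree ?(darboux_free D)//.
      by rewrite (eqP (darboux_free D)) addnK.
    by rewrite row_free_unit unitmx_tr; case: Os.
  apply/sub_kermxP; have /submxP[C ->] : (W <= F)%MS by rewrite (darboux_eqmx D).
  by rewrite -mulmxA (mulmxA F) (darbouxFF D) mulmx0.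
apply: etrans (eqP Hf); rewrite -(mxrank_mul_ker H (Omega *m F^T)) mulmxA.
by rewrite (cap_eqmx HV Wk).
Qed.

Lemma train1_frame Omega W F G H :
  symplectic Omega -> darboux Omega W F G -> row_free H ->
  \det (H *m Omega *m F^T) = 0 -> \adj (H *m Omega *m F^T) != 0 ->
  train1 W (proj H).
Proof.
move=> Os D Hf d0 a0; split; first exact: proj_Gr.
have r := rank_cap_frame Os D Hf (eqmx_sym (proj_eqmx Hf)).
apply/eqP; rewrite -(eqn_add2l (\rank (H *m Omega *m F^T))) r addn1.
by rewrite (rank_adj_neq0 d0 a0).
Qed.

End Frames.

(** * Tangent vectors of the Grassmannian and normal vectors of the train *)

Section TangentGr.
Context {R : realType} {n : nat}.
Local Notation E := 'M[R]_(n + n).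
Implicit Types (Omega W V v : E) (F G H : 'M[R]_(n, n + n)).

(** By Cramer's rule the inverse Gram matrix is its adjugate over its determinant, a polynomial
    without real zeros. *)
Lemma affine_proj_ratcurve H D : (forall t : R, row_free (H + t *: D)) ->
  exists (q : {poly R}) (p : 'M[{poly R}]_(n + n)),
    (forall t, q.[t] != 0) /\ (fun t => proj (H + t *: D)) = ratcurve q 1 p.
Proof.
move=> Kf; pose Kp := map_mx polyC H + 'X *: map_mx polyC D.
have KpE t : map_mx (horner_eval t) Kp = H + t *: D.
  by apply/matrixP => i j; rewrite !mxE /horner_eval !hornerE mulrC.
have grE t : map_mx (horner_eval t) (Kp *m Kp^T) =
    (H + t *: D) *m (H + t *: D)^T.
  by rewrite map_mxM -map_trmx KpE.
exists (\det (Kp *m Kp^T)), (Kp^T *m \adj (Kp *m Kp^T) *m Kp).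
have dE t : (\det (Kp *m Kp^T)).[t] = \det ((H + t *: D) *m (H + t *: D)^T).
  by rewrite -grE det_map_mx.
split=> [t|]; first by rewrite dE -unitfE -unitmxE gram_unit.
apply/funext => t; rewrite /ratcurve expr1 dE.
rewrite -[RHS]/(_ *: map_mx (horner_eval t) _) !map_mxM map_mx_adj.
rewrite grE -map_trmx KpE /proj /lpinv /invmx gram_unit//.
by rewrite -scalemxAr -scalemxAl.
Qed.

(** The two equations on [v] linearize symmetry and idempotence of projectors. The witness is the
    subspace spanned by the frame [H + t *: (H *m v)], whose velocity at 0 is read off from
    [projB]. *)
Lemma tangent_Gr W v : Gr W -> v^T = v -> v = v *m W + W *m v ->
  tangent (@Gr R n) W v.
Proof.
move=> GrW vs vE; have [H [Hf HW WH HWH]] := Gr_frame GrW.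
have [Ws Wi _] := GrW.
have WvW : W *m v *m W = 0.
  have := congr1 (fun x => W *m x *m W) vE.
  rewrite mulmxDr mulmxDl !mulmxA Wi -(mulmxA _ W W) Wi.
  by move=> e; apply: (@addrI _ (W *m v *m W)); rewrite -e addr0.
have HvH : H *m v *m H^T = 0.
  rewrite -{1}HWH -[in H^T]HWH trmx_mul Ws !mulmxA -(mulmxA H) -(mulmxA H).
  by rewrite WvW mulmx0 mul0mx.
(* Multiplication by [H^T] removes the added term because [H *m v *m H^T = 0]; hence the curve is
   defined for all [t]. *)
have Kf (t : R) : row_free (H + t *: (H *m v)).
  apply: inj_row_free => u /(congr1 (fun x => x *m H^T)).
  rewrite mul0mx mulmxDr mulmxDl -scalemxAr -scalemxAl -mulmxA.
  rewrite -(mulmxA u (H *m v)) HvH mulmx0 scaler0 addr0 mulmxA => uH.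
  by apply: (row_free_inj (A := H *m H^T));
    rewrite ?row_free_unit ?gram_unit// mulmxA uH mul0mx.
have [q [p [q0 cE]]] := affine_proj_ratcurve Kf.
exists (fun t => proj (H + t *: (H *m v))); split.
- by rewrite cE; exact: ratcurve_smooth.
- by apply: filterE => t; exact: proj_Gr.
- by rewrite scale0r addr0.
pose K (t : R) : 'M[R]_(n, n + n) := H + t *: (H *m v).
have cK : K t @[t --> (0 : R)^'] --> H by exact: cvg_line.
pose Q V := 1%:M - V.
have lim_v : lpinv (K h) *m (H *m v) *m Q W +
    (lpinv H *m (H *m v) *m Q (proj (K h)))^T @[h --> 0^'] --> v.
  rewrite [X in _ --> X](_ : v = lpinv H *m (H *m v) *m Q W +
     (lpinv H *m (H *m v) *m Q (proj H))^T); last first.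
    rewrite -WH mulmxA -/(proj H) -WH trmx_mul [(Q W)^T]linearB /= trmx1.
    rewrite trmx_mul Ws vs -/(Q W) /Q mulmxBr mulmxBl mulmx1 mul1mx mulmxA.
    by rewrite WvW !subr0 addrC -vE.
  apply: cvgD.
    apply: cvg_mulmx; last exact: cvg_cst.
    by apply: cvg_mulmx; [exact: cvg_lpinv|exact: cvg_cst].
  apply: cvg_trmx; apply: cvg_mulmx; first exact: cvg_cst.
  by apply: cvgB; [exact: cvg_cst|exact: cvg_proj].
rewrite /derive1; apply/cvg_lim => //.
apply: cvg_trans lim_v; apply: near_eq_cvg.
apply: filterS (nbhs_dnbhs_neq (0 : R)) => h h0.
rewrite !addr0 scale0r addr0 -/(K h) projB//; last exact: Kf.
have -> : K h - H = h *: (H *m v) by rewrite addrC addKr.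
rewrite -!scalemxAr -!scalemxAl linearZ /= -scalerDr scalerA mulVf// scale1r.
by rewrite -WH.
Qed.

End TangentGr.

Section NormalField.
Context {R : realType} {n : nat}.
Local Notation E := 'M[R]_(n + n).
Implicit Types (Omega W V v : E) (F G H : 'M[R]_(n, n + n)) (S : 'M[R]_n).

Lemma smooth_is_derive p q (c : R -> 'M[R]_(p, q)) (t : R) i j :
  smooth_on setT c -> is_derive t 1 (fun x => c x i j) (derive1 c t i j).
Proof.
move=> /(_ 1%N)[/(_ t I)/derivable1_diffP dc _].
rewrite derive1E derive_mx// mxE; apply/derivableP.
by move/derivable_mxP: dc; exact.
Qed.

Lemma smooth_cst (W' : normedModType R) (a : W') :
  smooth_on setT (fun _ : R => a).
Proof.
move=> d; elim: d a => [|d IH] a /=; first by move=> x _; exact: cst_continuous.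
split=> [x _|v]; first exact: differentiable_cst.
rewrite (_ : (fun x => _) = fun=> 0); first exact: IH.
by apply/funext => x; rewrite diff_cst.
Qed.

Lemma tangent0 (W' : normedModType R) (Z : set W') x : Z x -> tangent Z x 0.
Proof.
move=> Zx; exists (fun=> x); split=> //; first exact: smooth_cst.
  exact: filterE.
by rewrite derive1_cst.
Qed.

(* Moves V in the direction of the homomorphism to the span of G that has matrix
   S in the frame G; it depends on V and not on a choice of frame of V, so that
   its values at the ends of two paths can be compared. *)
Definition nfield Omega G S V : E :=
  V *m (Omega *m G^T *m S *m G) *m (1%:M - V) +
  (V *m (Omega *m G^T *m S *m G) *m (1%:M - V))^T.

Lemma nfield_tangent Omega G S V : Gr V ->
  tangent (@Gr R n) V (nfield Omega G S V).
Proof.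
move=> GrV; have [Vs Vi _] := GrV; rewrite /nfield.
move: (Omega *m G^T *m S *m G) => Y.
set X := V *m Y *m (1%:M - V).
have VX : V *m X = X by rewrite /X !mulmxA Vi.
have XV : X *m V = 0 by rewrite -mulmxA mulmxBl mul1mx Vi subrr mulmx0.
have VXT : V *m X^T = 0 by rewrite -{1}Vs -trmx_mul XV trmx0.
have XTV : X^T *m V = X^T by rewrite -{1}Vs -trmx_mul VX.
apply: tangent_Gr => //; first by rewrite linearD /= trmxK addrC.
by rewrite mulmxDl mulmxDr VX XV VXT XTV add0r addr0 addrC.
Qed.

Lemma nfieldN Omega G S V : nfield Omega G (- S) V = - nfield Omega G S V.
Proof.
by rewrite /nfield mulmxN !(mulNmx, mulmxN) linearN /= opprD.
Qed.

Lemma cvg_nfield T (FT : set_system T) (FF : Filter FT) Omega G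
    (s : T -> 'M[R]_n) (f : T -> E) S V :
  s @ FT --> S -> f @ FT --> V ->
  nfield Omega G (s x) (f x) @[x --> FT] --> nfield Omega G S V.
Proof.
move=> sS fV.
have X : f x *m (Omega *m G^T *m s x *m G) *m (1%:M - f x) @[x --> FT] -->
    V *m (Omega *m G^T *m S *m G) *m (1%:M - V).
  apply: cvg_mulmx.
    apply: cvg_mulmx => //; apply: cvg_mulmx; last exact: cvg_cst.
    by apply: cvg_mulmx => //; exact: cvg_cst.
  by apply: cvgB => //; exact: cvg_cst.
by apply: cvgD => //; exact: cvg_trmx.
Qed.

(** Along a curve in the train, the determinant of [K t] vanishes near 0, so Jacobi's formula makes
    a trace vanish. For the velocity [nfield] that trace is, up to sign, the one assumed nonzero. *)
Lemma nfield_not_tangent Omega W F G H S :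
  symplectic Omega -> darboux Omega W F G -> row_free H ->
  \det (H *m Omega *m F^T) = 0 ->
  \tr (\adj (H *m Omega *m F^T) *m (H *m Omega *m G^T *m S)) != 0 ->
  ~ tangent (train1 W) (proj H) (nfield Omega G S (proj H)).
Proof.
move=> Os D Hf; set B := H *m Omega *m F^T; set A := H *m Omega *m G^T.
move=> detB trB [c [cs cZ c0 cv]].
pose K t := H *m c t *m (Omega *m F^T).
have dK i j : is_derive (0 : R) 1 (fun t => K t i j)
    ((H *m derive1 c 0 *m (Omega *m F^T)) i j).
  have Dc k l : is_derive (0 : R) 1 (fun t => c t k l) (derive1 c 0 k l).
    exact: smooth_is_derive.
  rewrite (_ : (fun t => _) = fun t =>
      \sum_l \sum_k (H i k * (Omega *m F^T) l j) *: c t k l); last first.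
    apply/funext => t; rewrite mxE; apply: eq_bigr => l _; rewrite mxE mulr_suml.
    by apply: eq_bigr => k _; rewrite /GRing.scale /= mulrAC.
  have -> : (H *m derive1 c 0 *m (Omega *m F^T)) i j =
      \sum_l \sum_k (H i k * (Omega *m F^T) l j) *: derive1 c 0 k l.
    rewrite mxE; apply: eq_bigr => l _; rewrite mxE mulr_suml.
    by apply: eq_bigr => k _; rewrite /GRing.scale /= mulrAC.
  by apply: is_derive_sumr => l; apply: is_derive_sumr => k.
have detK := is_derive_det dK.
(* If [K t] were invertible, [H *m c t] would be a frame of [c t], and [rank_cap_frame] would make
   [c t] transverse to [W]. *)
have det0 : \forall t \near (0 : R), \det (K t) = 0.
  apply: filterS cZ => t [[Vs Vi rV] rVW]; apply/eqP/negPn.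
  rewrite -unitfE -unitmxE; apply/negP => Ku.
  have Hcf : row_free (H *m c t).
    apply: inj_row_free => u /(congr1 (mulmx^~ (Omega *m F^T))).
    rewrite mul0mx -mulmxA => uK; apply: (can_inj (mulmxK Ku)).
    by rewrite mul0mx.
  have Hc : (H *m c t :=: c t)%MS.
    apply/eqmxP; rewrite -(geq_leqif (mxrank_leqif_eq (submxMl _ _))).
    by rewrite rV (eqP Hcf).
  have := rank_cap_frame Os D Hcf Hc.
  rewrite rVW -(mulmxA _ Omega) mxrank_unit// => /eqP.
  by rewrite -[X in _ == X]addn0 eqn_add2l.
have : \tr (\adj (K 0) *m (H *m derive1 c 0 *m (Omega *m F^T))) = 0.
  have <- := @derive_val _ _ _ _ _ _ _ detK.
  rewrite (near_eq_derive (g := fun=> 0))// ?oner_neq0// derive_cst//.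
have KE : K 0 = B by rewrite /K c0 mul_proj// mulmxA.
rewrite KE cv /nfield.
have HYF : H *m (Omega *m G^T *m S *m G) *m (Omega *m F^T) = - (A *m S).
  rewrite !mulmxA -(mulmxA _ G) -(mulmxA _ (G *m Omega)).
  by rewrite (darbouxGF Os D) mulmxN mulmx1.
move: (Omega *m G^T *m S *m G) HYF => Y HYF.
have VE : proj H = lpinv H *m H by [].
have HQ := mul_compl_proj Hf.
move: (proj H) VE HQ (mul_proj Hf) (proj_sym H) => V VE HQ HV Vs.
have -> : H *m (V *m Y *m (1%:M - V) + (V *m Y *m (1%:M - V))^T) =
    H *m Y *m (1%:M - V).
  rewrite mulmxDr 2!trmx_mul [(1%:M - _)^T]linearB /= trmx1 Vs.
  by rewrite !mulmxA HV HQ !mul0mx addr0.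
(* The last term has [B] as its right factor, so against the adjugate of [B] its trace is a multiple
   of [\det B], which is 0; only [A *m S] contributes. *)
have -> : H *m Y *m (1%:M - V) *m (Omega *m F^T) =
    - (A *m S) - H *m Y *m lpinv H *m B.
  by rewrite mulmxBr mulmx1 mulmxBl HYF VE /B !mulmxA.
move: (H *m Y *m lpinv H) => C.
rewrite mulmxBr raddfB /= mxtrace_mulC -[X in _ - X]mxtrace_mulC.
rewrite -(mulmxA C) mul_mx_adj detB (raddf0 (@scalar_mx R n)) mulmx0 raddf0 subr0.
by rewrite mxtrace_mulC mulmxN raddfN /= => /eqP; rewrite oppr_eq0 (negPf trB).
Qed.

End NormalField.

(** * Strict differentiability and retractions onto submanifolds *)

Section StrictDerivative.
Context {R : realType}.

(* The two-point condition bounds Lipschitz constants of f - L near x0, which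
   Frechet differentiability at x0 does not. *)
Definition strict_diff (V W : normedModType R) (f : V -> W) (x0 : V)
    (L : V -> W) :=
  forall e : R, 0 < e -> exists2 r : R, 0 < r & forall x y,
    `|x - x0| < r -> `|y - x0| < r ->
    `|f x - f y - L (x - y)| <= e * `|x - y|.

Lemma mx_linear_bounded (W : normedModType R) m n
    (f : {linear 'M[R]_(m, n) -> W}) :
  exists2 C : R, 0 < C & forall x, `|f x| <= C * `|x|.
Proof.
exists (1 + \sum_i \sum_j `|f (delta_mx i j)|).
  by rewrite ltr_pwDl// sumr_ge0// => i _; rewrite sumr_ge0.
move=> x; rewrite {1}[x]matrix_sum_delta linear_sum.
apply: (@le_trans _ _ (\sum_i \sum_j `|f (delta_mx i j)| * `|x|)); last first.
  rewrite mulrDl mul1r -[leLHS]add0r lerD// mulr_suml.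
  by apply: ler_sum => i _; rewrite mulr_suml.
apply: le_trans (ler_norm_sum _ _ _) _; apply: ler_sum => i _.
rewrite linear_sum; apply: le_trans (ler_norm_sum _ _ _) _.
apply: ler_sum => j _; rewrite linearZ normrZ mulrC ler_wpM2l//.
exact: le_mx_norm.
Qed.

Lemma strict_diff_comp m n (W W' : normedModType R)
    (f : 'M[R]_(m, n) -> W) (g : W -> W') x0
    (L : {linear 'M[R]_(m, n) -> W}) (M : {linear W -> W'}) (C : R) :
  0 < C -> (forall w, `|M w| <= C * `|w|) ->
  strict_diff f x0 L -> strict_diff g (f x0) M ->
  strict_diff (g \o f) x0 (M \o L).
Proof.
move=> C0 MC fL gM e e0; have [CL CL0 LC] := mx_linear_bounded L.
(* The bound 1 yields the Lipschitz constant [CL + 1] for [f] near [x0]; the other bound, carried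
   through [M], costs half of [e]. *)
pose e1 := Num.min 1 (e / (2 * C)).
have e10 : 0 < e1 by rewrite lt_min ltr01 divr_gt0// mulr_gt0.
pose e2 := e / (2 * (CL + 1)).
have CL1 : 0 < CL + 1 by rewrite ltr_pwDl// ltW.
have e20 : 0 < e2 by rewrite divr_gt0// mulr_gt0.
have [r1 r10 fr] := fL _ e10; have [r2 r20 gr] := gM _ e20.
have fLip x y : `|x - x0| < r1 -> `|y - x0| < r1 ->
    `|f x - f y| <= (CL + 1) * `|x - y|.
  move=> xr yr; rewrite -[f x - f y](subrK (L (x - y))).
  apply: le_trans (ler_normD _ _) _; rewrite mulrDl mul1r addrC lerD//.
  apply: le_trans (fr _ _ xr yr) _.
  by rewrite -[leRHS]mul1r ler_wpM2r// ge_min lexx.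
exists (Num.min r1 (r2 / (CL + 1))); first by rewrite lt_min r10 divr_gt0.
move=> x y; rewrite !lt_min => /andP[x1 x2] /andP[y1 y2] /=.
have x00 : `|x0 - x0| < r1 by rewrite subrr normr0.
have small z : `|z - x0| < r1 -> `|z - x0| < r2 / (CL + 1) ->
    `|f z - f x0| < r2.
  move=> z1 z2; apply: le_lt_trans (fLip _ _ z1 x00) _.
  by rewrite mulrC -ltr_pdivlMr.
rewrite -[_ - _ - _](subrKA (M (f x - f y))) -linearB.
apply: le_trans (ler_normD _ _) _.
have -> : e * `|x - y| = e2 * ((CL + 1) * `|x - y|) + C * (e / (2 * C) * `|x - y|).
  by rewrite /e2; field; rewrite !gt_eqF.
apply: lerD.
  apply: le_trans (gr _ _ (small _ x1 x2) (small _ y1 y2)) _.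
  by rewrite ler_wpM2l ?(ltW e20)// fLip.
apply: le_trans (MC _) _; rewrite ler_wpM2l ?(ltW C0)//.
apply: le_trans (fr _ _ x1 y1) _.
by rewrite ler_wpM2r// ge_min lexx orbT.
Qed.

Lemma strict_diff_cvg (V W : normedModType R) (f : V -> W) x0
    (L : {linear V -> W}) v : strict_diff f x0 L ->
  t^-1 *: (f (x0 + t *: v) - f x0) @[t --> (0 : R)^'] --> L v.
Proof.
move=> fL; apply/cvgrPdist_le => e e0.
have v1 : 0 < `|v| + 1 by rewrite ltr_wpDl.
have [r r0 fr] := fL (e / (`|v| + 1)) (divr_gt0 e0 v1).
near=> t.
have t0 : t != 0 by near: t; exact: nbhs_dnbhs_neq.
have tr : `|t *: v| < r.
  rewrite normrZ (@le_lt_trans _ _ (`|t| * (`|v| + 1)))//.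
    by rewrite ler_wpM2l// lerDl.
  rewrite -ltr_pdivlMr//; near: t; apply: dnbhs0_lt.
  by rewrite divr_gt0.
rewrite distrC -[L v]scale1r -(mulVf t0) -scalerA -scalerBr -linearZ.
have := fr (x0 + t *: v) x0; rewrite addrC addrA addNr add0r subrr normr0.
rewrite addrC => /(_ tr r0) H.
rewrite normrZ normfV ler_pdivrMl ?normr_gt0//; apply: le_trans H _.
rewrite normrZ mulrAC ler_pdivrMr//.
rewrite mulrCA mulrA ler_wpM2l ?mulr_ge0 ?(ltW e0)//.
by rewrite lerDl.
Unshelve. all: by end_near. Qed.

Lemma segment_ball (V : normedModType R) (x0 x y : V) (r c : R) :
  0 <= c <= 1 -> `|x - x0| < r -> `|y - x0| < r ->
  `|y + c *: (x - y) - x0| < r.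
Proof.
move=> /andP[c0 c1] xr yr.
have -> : y + c *: (x - y) - x0 = (1 - c) *: (y - x0) + c *: (x - x0).
  rewrite scalerBl scale1r -[RHS]addrA [X in _ = _ + X]addrC -scalerBr.
  by rewrite opprB addrA subrK addrAC.
apply: le_lt_trans (ler_normD _ _) _; rewrite !normrZ !ger0_norm ?subr_ge0//.
have [->|c0'] := eqVneq c 0; first by rewrite mul0r addr0 subr0 mul1r.
rewrite [ltRHS](_ : r = (1 - c) * r + c * r); last by ring.
apply: ler_ltD.
  by rewrite ler_wpM2l ?subr_ge0// ltW.
by rewrite ltr_pM2l// lt_neqAle eq_sym c0'.
Qed.

(** The quantifier over [Z] comes after the neighbourhood: in [chart_strict], [Z] is the difference
    of the two points that are being compared. *)
Lemma near_mul_small m k p q (T : Type) (FT : set_system T) (FF : Filter FT)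
    (f : T -> 'M[R]_(m, k)) (g : T -> 'M[R]_(p, q))
    (A0 : 'M[R]_(m, k)) (B0 : 'M[R]_(p, q)) (e : R) :
  0 < e -> f @ FT --> A0 -> g @ FT --> B0 ->
  \forall t \near FT, forall Z : 'M[R]_(k, p),
    `|f t *m Z *m g t - A0 *m Z *m B0| <= e * `|Z|.
Proof.
move=> e0 fA gB.
pose c : R := p%:R * k%:R.
have c0 : 0 <= c by rewrite mulr_ge0.
have b0 : 0 < `|B0| + 1 by rewrite ltr_wpDl.
pose e1 : R := e / (2 * (c + 1) * (`|B0| + 1)).
pose e2 : R := e / (2 * (c + 1) * (`|A0| + 1)).
have c1 : 0 < c + 1 by rewrite ltr_wpDl.
have a0 : 0 < `|A0| + 1 by rewrite ltr_wpDl.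
have e10 : 0 < e1 by rewrite divr_gt0// !mulr_gt0.
have e20 : 0 < e2 by rewrite divr_gt0// !mulr_gt0.
have e21 : 0 < Num.min e2 1 by rewrite lt_min e20 ltr01.
move/cvgrPdist_le : fA => /(_ _ e10) fA.
move/cvgrPdist_le : gB => /(_ _ e21) gB.
apply: filterS2 fA gB => t; rewrite le_min distrC => fA /andP[gB gB1] Z.
rewrite distrC in gB.
have gb : `|g t| <= `|B0| + 1.
  rewrite -[g t](subrK B0) addrC; apply: le_trans (ler_normD _ _) _.
  by rewrite lerD2l distrC.
have -> : f t *m Z *m g t - A0 *m Z *m B0 =
    (f t - A0) *m Z *m g t + A0 *m Z *m (g t - B0).
  by rewrite !mulmxBl mulmxBr addrA subrK.
apply: le_trans (ler_normD _ _) _.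
have bound (a : 'M[R]_(m, k)) (b : 'M[R]_(p, q)) :
    `|a *m Z *m b| <= c * (`|a| * `|b|) * `|Z|.
  apply: le_trans (norm_mulmx_le _ _) _.
  have -> : c * (`|a| * `|b|) * `|Z| = p%:R * (k%:R * `|a| * `|Z|) * `|b|.
    by rewrite /c; ring.
  by rewrite ler_wpM2r// ler_wpM2l// norm_mulmx_le.
apply: le_trans (lerD (bound _ _) (bound _ _)) _.
rewrite -mulrDl ler_wpM2r// -mulrDr.
have h1 : `|f t - A0| * `|g t| <= e1 * (`|B0| + 1) by rewrite ler_pM.
have h2 : `|A0| * `|g t - B0| <= (`|A0| + 1) * e2.
  by rewrite ler_pM// lerDl.
apply: le_trans (ler_wpM2l c0 (lerD h1 h2)) _.
have -> : e1 * (`|B0| + 1) + (`|A0| + 1) * e2 = e / (c + 1).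
  by rewrite /e1 /e2; field; rewrite !gt_eqF.
by rewrite mulrCA -[leRHS]mulr1 ler_wpM2l ?(ltW e0)// ler_pdivrMr// mul1r lerDl.
Qed.

End StrictDerivative.

Lemma strict_diff_linear (R : realType) (V W : normedModType R)
    (L : {linear V -> W}) x0 : strict_diff L x0 L.
Proof.
move=> e e0; exists 1 => // x y _ _.
by rewrite linearB subrr normr0 mulr_ge0// ltW.
Qed.

Section Retraction.
Context {R : realType}.

Lemma is_derive_line (V W : normedModType R) (f : V -> W) (y h : V) (t : R) :
  differentiable f (y + t *: h) ->
  is_derive t 1 (fun c : R => f (y + c *: h)) ('d f (y + t *: h) h).
Proof.
move=> df; pose l (c : R) := y + c *: h.
have dl : is_diff t l (fun c => c *: h).
  have D := is_diffD (is_diff_cst y t) (is_diff_scalel t h).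
  by apply: is_diff_eq; rewrite add0r.
have D : is_diff t (f \o l) ('d f (l t) \o (fun c => c *: h)).
  by apply: is_diff_comp; exact: DiffDef.
have dfl : differentiable (f \o l) t by case: D.
have dE : 'd (f \o l) t = 'd f (l t) \o (fun c => c *: h) :> (R -> W) by case: D.
split; first exact: diff_derivable.
rewrite -[LHS]/('D_1 (f \o l) t) deriveE// dE /=.
by rewrite scale1r.
Qed.

Lemma near_dist_le (V W : normedModType R) (f : V -> W) x0 (e : R) :
  0 < e -> {for x0, continuous f} -> \forall x \near x0, `|f x - f x0| <= e.
Proof.
by move=> e0 /cvgrPdist_le/(_ _ e0); apply: filterS => x; rewrite distrC.
Qed.

(** The mean value theorem on the segment from [y] to [x] applies to each entry separately.
    Continuity of [D] at [x0] in each fixed direction is enough for uniformity, because there are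
    finitely many matrix units. *)
Lemma gateaux_strict_diff m n p q (U : set 'M[R]_(m, n))
    (f : 'M[R]_(m, n) -> 'M[R]_(p, q))
    (D : 'M[R]_(m, n) -> {linear 'M[R]_(m, n) -> 'M[R]_(p, q)}) x0 :
  open U -> U x0 ->
  (forall y h (t : R), U (y + t *: h) ->
     is_derive t 1 (fun c : R => f (y + c *: h)) (D (y + t *: h) h)) ->
  (forall v, {for x0, continuous (fun x => D x v)}) -> strict_diff f x0 (D x0).
Proof.
move=> Uo Ux0 df cdf e e0.
(* The error is added over [m * n] matrix units; the successor avoids a zero denominator for empty
   matrices. *)
pose e1 := e / (m * n).+1%:R.
have e10 : 0 < e1 by rewrite divr_gt0.
have e1E : (n * m)%N%:R * e1 <= e.
  rewrite /e1 mulrCA -[leRHS]mulr1 ler_wpM2l ?(ltW e0)//.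
  by rewrite ler_pdivrMr// mul1r ler_nat mulnC.
have {}e1E (c : R) : 0 <= c ->
    \sum_(i < m) \sum_(j < n) (c * e1) <= e * c.
  move=> c0; rewrite (eq_bigr (fun=> (c * e1) *+ n)) => [|i _]; last first.
    by rewrite sumr_const card_ord.
  rewrite sumr_const card_ord -mulrnA -mulr_natl mulrCA mulrC.
  by rewrite ler_wpM2r.
move: e1 e10 e1E => e1 e10 e1E.
have : \forall x \near x0, U x /\
    forall (i : 'I_m) (j : 'I_n),
    `|D x (delta_mx i j) - D x0 (delta_mx i j)| <= e1.
  apply: filterI; first exact: open_nbhs_nbhs.
  apply: (@filter_forall _ 'I_m (fun i x => forall j : 'I_n,
    `|D x (delta_mx i j) - D x0 (delta_mx i j)| <= e1) _
    (nbhs_filter x0)) => i.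
  apply: (@filter_forall _ 'I_n (fun j x =>
    `|D x (delta_mx i j) - D x0 (delta_mx i j)| <= e1) _
    (nbhs_filter x0)) => j.
  exact: (near_dist_le e10 (cdf (delta_mx i j))).
move=> /nbhs_ballP[r r0 rU]; exists r => // x y xr yr.
pose h := x - y; rewrite -/h.
apply: mx_norm_le => [|k l]; first by rewrite mulr_ge0// ltW.
have near_seg (c : R) : 0 <= c <= 1 -> U (y + c *: h) /\
    forall i j, `|D (y + c *: h) (delta_mx i j) - D x0 (delta_mx i j)| <= e1.
  move=> c01; apply: rU; rewrite -ball_normE /= distrC.
  exact: segment_ball.
have Dg (c : R) : 0 <= c <= 1 ->
    is_derive c 1 (fun t => f (y + t *: h) k l) (D (y + c *: h) h k l).
  move=> /near_seg[Uc _]; have Dl := df _ _ _ Uc.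
  split.
    have /derivable_mxP := @ex_derive _ _ _ _ _ _ _ Dl; exact.
  have := @derive_val _ _ _ _ _ _ _ Dl.
  rewrite derive_mx; last exact: (@ex_derive _ _ _ _ _ _ _ Dl).
  by move=> /matrixP/(_ k l); rewrite mxE.
have [||c c01] := @MVT_segment R (fun t => f (y + t *: h) k l)
    (fun c => D (y + c *: h) h k l) 0 1 ler01.
- move=> c; rewrite in_itv /= => /andP[c0 c1]; apply: Dg.
  by rewrite !ltW.
- apply: derivable_within_continuous => c; rewrite in_itv /= => c01.
  exact: (@ex_derive _ _ _ _ _ _ _ (Dg c c01)).
have yh : y + h = x by rewrite addrC subrK.
rewrite scale1r scale0r addr0 yh subr0 mulr1 => fE.
move: c01; rewrite in_itv /= => /near_seg[_ small].
rewrite !mxE fE; move: (D (y + c *: h)) small => Dc small.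
have -> : Dc h k l - D x0 h k l =
    \sum_i \sum_j h i j *
      (Dc (delta_mx i j) - D x0 (delta_mx i j)) k l.
  rewrite {1 2}[h]matrix_sum_delta !linear_sum !summxE -sumrB.
  apply: eq_bigr => i _; rewrite !linear_sum !summxE -sumrB.
  by apply: eq_bigr => j _; rewrite !linearZ !mxE mulrBr.
apply: le_trans (_ : \sum_(i < m) \sum_(j < n) (`|h| * e1) <= _).
  apply: le_trans (ler_norm_sum _ _ _) _; apply: ler_sum => i _.
  apply: le_trans (ler_norm_sum _ _ _) _; apply: ler_sum => j _.
  rewrite normrM ler_pM// ?le_mx_norm//.
  exact: le_trans (le_mx_norm _ _ _) (small i j).
exact: e1E.
Qed.

Lemma C1_strict_diff m n p q (U : set 'M[R]_(m, n))
    (f : 'M[R]_(m, n) -> 'M[R]_(p, q)) x0 :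
  open U -> U x0 -> Ck 1 U f -> strict_diff f x0 ('d f x0).
Proof.
move=> Uo Ux0 [df cdf].
apply: (@gateaux_strict_diff _ _ _ _ U f (fun x => 'd f x)) => // [y h t Uy|v].
  exact/is_derive_line/df.
exact: cdf.
Qed.

(** The retraction is [phi \o chi], with [a] and [b] the differentials of [chi] and [phi].
    Differentiating [chi (phi y) = y] gives [cancel b a], so [b \o a] is a projection onto the
    tangent space, which [b] parametrizes by k coordinates. *)
Lemma submanifold_retraction m n k (M : set 'M[R]_(m, n)) x :
  smooth_submanifold k M -> M x ->
  exists (rho : 'M[R]_(m, n) -> 'M[R]_(m, n))
    (a : {linear 'M[R]_(m, n) -> 'rV[R]_k})
    (b : {linear 'rV[R]_k -> 'M[R]_(m, n)}),
  [/\ strict_diff rho x (b \o a), cancel b a,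
      \forall z \near x, M (rho z) /\ {for z, continuous rho} &
      \forall z \near x, M z -> rho z = z].
Proof.
move=> Msub /[dup] Mx /Msub [U [V [phi [chi]]]].
case=> -[Uo Ux] Vo phis chis [phiO chiK].
have phiMU y : V y -> (M `&` U) (phi y) by rewrite -phiO => Oy; exists y.
have MUphi z : M z -> U z -> V (chi z) /\ phi (chi z) = z.
  move=> Mz Uz; have : (M `&` U) z by [].
  by rewrite -phiO => -[y Oy <-]; rewrite chiK.
have [Ox phix] := MUphi _ Mx Ux.
have chic z : U z -> {for z, continuous chi}.
  by move=> Uz; case: (chis 1%N) => /(_ _ Uz)/differentiable_continuous.
have phic y : V y -> {for y, continuous phi}.
  by move=> Oy; case: (phis 1%N) => /(_ _ Oy)/differentiable_continuous.
have schi := C1_strict_diff Uo Ux (chis 1%N).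
have sphi := C1_strict_diff Vo Ox (phis 1%N).
have nU : \forall z \near x, U z by exact: open_nbhs_nbhs.
have nO : \forall z \near x, V (chi z).
  by apply: (chic _ Ux); exact: open_nbhs_nbhs.
have [Cphi Cphi0 Cphib] := mx_linear_bounded ('d phi (chi x)).
have [Cchi Cchi0 Cchib] := mx_linear_bounded ('d chi x).
exists (phi \o chi), ('d chi x), ('d phi (chi x)); split.
- exact: (strict_diff_comp Cphi0 Cphib schi sphi).
(* The difference quotients of [chi \o phi] tend to [a (b w)] by the chain rule, and equal [w] since
   this composite is the identity on [V]. *)
- move=> w.
  have schi' : strict_diff chi (phi (chi x)) ('d chi x) by rewrite phix.
  have s := strict_diff_comp Cchi0 Cchib sphi schi'.
  have lim1 := @strict_diff_cvg R _ _ (chi \o phi) (chi x)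
    ('d chi x \o 'd phi (chi x) : {linear 'rV[R]_k -> 'rV[R]_k}) w s.
  have nV : \forall t \near (0 : R)^', V (chi x + t *: w).
    by apply: (@cvg_line _ _ (chi x) w V); exact: open_nbhs_nbhs.
  have lim2 : t^-1 *: ((chi \o phi) (chi x + t *: w) - (chi \o phi) (chi x))
      @[t --> (0 : R)^'] --> w.
    apply: (cvg_trans _ (@cvg_cst _ w _ ((0 : R)^') _)); apply: near_eq_cvg.
    apply: filterS2 nV (nbhs_dnbhs_neq (0 : R)) => t Vt t0 /=.
    rewrite !chiK// [X in _ *: X]addrC addKr scalerA mulVf// scale1r//.
  exact: cvg_unique lim1 lim2.
- apply: filterS2 nU nO => z Uz Oz; split; first by case: (phiMU _ Oz).
  by apply: continuous_comp; [exact: chic|exact: phic].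
- by apply: filterS nU => z Uz Mz; case: (MUphi _ Mz Uz).
Qed.

End Retraction.

(** * Graph charts at a Lagrangian subspace *)

Section Chart.
Context {R : realType} {n : nat}.
Local Notation E := 'M[R]_(n + n).
Context (Omega W : E) (F G : 'M[R]_(n, n + n)).
Hypotheses (Os : symplectic Omega) (D : darboux Omega W F G) (GrW : Gr W).
Implicit Types (A B X Y Z : 'M[R]_n) (V v : E).

Lemma frame_coordG A B : (A *m F + B *m G) *m Omega *m G^T = A.
Proof.
rewrite !mulmxDl -!(mulmxA A) -!(mulmxA B) (darbouxFG D) (darbouxGG D).
by rewrite mulmx1 mulmx0 addr0.
Qed.

Lemma frame_coordF A B : (A *m F + B *m G) *m Omega *m F^T = - B.
Proof.
rewrite !mulmxDl -!(mulmxA A) -!(mulmxA B) (darbouxFF D) (darbouxGF Os D).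
by rewrite mulmx0 mulmxN mulmx1 add0r.
Qed.

Lemma chart_free X : row_free (F + X *m G).
Proof.
apply: inj_row_free => u /(congr1 (fun x => x *m Omega *m G^T)).
rewrite -{1}[F]mul1mx -!mulmxA (mulmxA _ Omega) frame_coordG mulmx1.
by rewrite mul0mx.
Qed.

Lemma Lagrangian_frame A B : row_free (A *m F + B *m G) ->
  A *m B^T = B *m A^T -> Lagrangian Omega (proj (A *m F + B *m G)).
Proof.
move=> Hf AB; split; first exact: proj_Gr.
have HH : (A *m F + B *m G) *m Omega *m (A *m F + B *m G)^T = 0.
  rewrite [(_ + _)^T]linearD /= !trmx_mul mulmxDr !mulmxA.
  by rewrite frame_coordG frame_coordF AB mulNmx addNr.
by rewrite /proj trmx_mul -!mulmxA (mulmxA _ Omega) (mulmxA _ _ (lpinv _)^T)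
  mulmxA HH mul0mx mulmx0.
Qed.

Definition chart X : E := proj (F + X *m G).

Lemma chart_Lagrangian X : X^T = X -> Lagrangian Omega (chart X).
Proof.
move=> Xs; rewrite /chart -{1}[F]mul1mx; apply: Lagrangian_frame.
  by rewrite mul1mx; exact: chart_free.
by rewrite mul1mx trmx1 mulmx1 Xs.
Qed.

Lemma ref_proj : W = proj F.
Proof.
have [Ws Wi _] := GrW; apply: proj_uniq => //; first exact: darboux_free D.
exact/eqmx_sym/(darboux_eqmx D).
Qed.

Lemma chart0 : chart 0 = W.
Proof. by rewrite /chart mul0mx addr0 -ref_proj. Qed.

Lemma frame_mul_ref : F *m W = F.
Proof. by rewrite ref_proj mul_proj// (darboux_free D). Qed.

Lemma cvg_chart T (FT : set_system T) (FF : Filter FT) (f : T -> 'M[R]_n) X :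
  f @ FT --> X -> chart (f x) @[x --> FT] --> chart X.
Proof.
move=> fX; apply: cvg_proj; first exact: chart_free.
apply: cvgD; first exact: cvg_cst.
by apply: cvg_mulmx => //; exact: cvg_cst.
Qed.

(** These are the coordinates of [F *m V] in the frame, so [invmx (coordA V) *m coordB V] inverts
    the chart. The numerator [coordB] is used alone because it is linear in [V], has the right first
    order behaviour at [W], and is singular on the same subspaces where [coordA V] is invertible. *)
Definition coordA V : 'M[R]_n := F *m V *m Omega *m G^T.
Definition coordB V : 'M[R]_n := - (F *m V *m Omega *m F^T).

Lemma coordB_linear : linear coordB.
Proof.
move=> a u v; rewrite /coordB mulmxDr !mulmxDl opprD -scalemxAr -!scalemxAl.
by rewrite scalerN.
Qed.
HB.instance Definition _ := GRing.isLinear.Build R _ _ _ coordB coordB_linear.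

Lemma coordB_ref : coordB W = 0.
Proof. by rewrite /coordB frame_mul_ref (darbouxFF D) oppr0. Qed.

Lemma coordA_ref : coordA W = 1%:M.
Proof. by rewrite /coordA frame_mul_ref (darbouxFG D). Qed.

Lemma frame_coord V : F *m V = coordA V *m F + coordB V *m G.
Proof. by rewrite {1}(darboux_decomp (F *m V) Os D) mulNmx. Qed.

Lemma Gr_frameE V : Gr V -> coordA V \in unitmx ->
  row_free (F *m V) /\ V = proj (F *m V).
Proof.
move=> GrV Au; have FVf : row_free (F *m V).
  apply: inj_row_free => u /(congr1 (fun x => x *m Omega *m G^T)).
  rewrite -!mulmxA !(mulmxA F) !(mulmxA (F *m V)) -/(coordA V) mul0mx => uA.
  by apply: (can_inj (mulmxK Au)); rewrite uA mul0mx.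
by split=> //; case: (Gr_sub_eqmx GrV FVf (submxMl _ _)).
Qed.

Lemma chart_surj V : Gr V -> coordA V \in unitmx ->
  V = chart (invmx (coordA V) *m coordB V).
Proof.
move=> GrV Au; have [FVf {1}->] := Gr_frameE GrV Au.
rewrite frame_coord -[X in proj X](_ : coordA V *m
  (F + invmx (coordA V) *m coordB V *m G) = _).
  by rewrite proj_lin// chart_free.
by rewrite mulmxDr !mulmxA mulmxV// mul1mx.
Qed.

Definition dchart Z : E :=
  lpinv F *m Z *m G *m (1%:M - W) + (lpinv F *m Z *m G *m (1%:M - W))^T.

Lemma dchart_linear : linear dchart.
Proof.
move=> a X Y; rewrite /dchart; move: (1%:M - W) => Q.
rewrite mulmxDr !mulmxDl linearD /=.
rewrite -scalemxAr -!scalemxAl linearZ /= scalerDr.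
exact: addrACA.
Qed.
HB.instance Definition _ := GRing.isLinear.Build R _ _ _ dchart dchart_linear.

Lemma mul_compl_ref : F *m (1%:M - W) = 0.
Proof. by rewrite mulmxBr mulmx1 frame_mul_ref subrr. Qed.

Lemma coordB_dchart Z : coordB (dchart Z) = Z.
Proof.
have [Ws _ _] := GrW.
have WOF : W *m Omega *m F^T = 0.
  have /submxP[C ->] : (W <= F)%MS by rewrite (darboux_eqmx D).
  by rewrite -!mulmxA (mulmxA F) (darbouxFF D) mulmx0.
have Qs : (1%:M - W)^T = 1%:M - W by rewrite [LHS]linearB /= trmx1 Ws.
have FT : F *m dchart Z = Z *m G *m (1%:M - W).
  rewrite /dchart mulmxDr trmx_mul Qs (mulmxA F (1%:M - W)) mul_compl_ref.
  rewrite mul0mx addr0 -(mulmxA _ G) -(mulmxA _ Z) mulmxA.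
  by rewrite mul_lpinv ?(darboux_free D)// mul1mx !mulmxA.
rewrite /coordB FT -(mulmxA _ Omega) -(mulmxA _ (1%:M - W)) mulmxBl mul1mx.
rewrite (mulmxA W) WOF subr0 mulmxA -(mulmxA Z) -(mulmxA Z) (darbouxGF Os D).
by rewrite mulmxN mulmx1 opprK.
Qed.

(** The tangency equation forces [W *m v *m W = 0], so [v] is recovered from its off-diagonal block
    [W *m v] and the transpose, and [coordB] records that block. *)
Lemma dchart_coordB v : v^T = v -> v = v *m W + W *m v -> dchart (coordB v) = v.
Proof.
move=> vs vE; have [Ws Wi _] := GrW.
have WvW : W *m v *m W = 0.
  have := congr1 (fun x => W *m x *m W) vE.
  rewrite mulmxDr mulmxDl !mulmxA Wi -(mulmxA _ W W) Wi.
  by move=> e; apply: (@addrI _ (W *m v *m W)); rewrite -e addr0.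
have X : lpinv F *m coordB v *m G *m (1%:M - W) = W *m v.
  have : F *m v *m (1%:M - W) = coordB v *m G *m (1%:M - W).
    rewrite frame_coord mulmxDl -(mulmxA _ F) mul_compl_ref mulmx0.
    by rewrite add0r.
  move=> e; transitivity (lpinv F *m (coordB v *m G *m (1%:M - W))).
    by rewrite !mulmxA.
  rewrite -e !mulmxA -[lpinv F *m F]/(proj F) -ref_proj mulmxBr mulmx1.
  by rewrite WvW subr0.
by rewrite /dchart X trmx_mul vs Ws addrC -vE.
Qed.

(** [projB] writes the increment as two terms linear in [X - Y], whose outer factors tend to those
    of [dchart]; each term costs [e / 2]. *)
Lemma chart_strict : strict_diff chart 0 dchart.
Proof.
move=> e e0; have e20 : 0 < e / 2 by rewrite divr_gt0.
pose z0 : 'M[R]_n * 'M[R]_n := (0, 0).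
have cH : p.1 @[p --> nbhs z0] --> (0 : 'M[R]_n).
  exact: cvg_fst.
have cH2 : p.2 @[p --> nbhs z0] --> (0 : 'M[R]_n).
  exact: cvg_snd.
pose fr X := F + X *m G.
have cfr T (FT : set_system T) (FF : Filter FT) (f : T -> 'M[R]_n) :
    f @ FT --> (0 : 'M[R]_n) -> lpinv (fr (f x)) @[x --> FT] --> lpinv F.
  move=> f0; have -> : lpinv F = lpinv (F + 0 *m G) by rewrite mul0mx addr0.
  apply: cvg_lpinv; first exact: chart_free.
  apply: cvgD; first exact: cvg_cst.
  by apply: cvg_mulmx => //; exact: cvg_cst.
have cQ T (FT : set_system T) (FF : Filter FT) (f : T -> 'M[R]_n) :
    f @ FT --> (0 : 'M[R]_n) -> G *m (1%:M - chart (f x)) @[x --> FT] -->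
      G *m (1%:M - W).
  move=> f0; apply: cvg_mulmx; first exact: cvg_cst.
  apply: cvgB; first exact: cvg_cst.
  by rewrite -chart0; exact: cvg_chart.
have n1 := near_mul_small _ e20 (cfr _ _ _ _ cH) (cQ _ _ _ _ cH2).
have n2 := near_mul_small _ e20 (cfr _ _ _ _ cH2) (cQ _ _ _ _ cH).
have [/= [A1 A2] [A10 A20] An] := filterI (n1 _ _ _) (n2 _ _ _).
have [r r0 Ar] := cvg_near0_norm (filterI A10 A20).
exists r => // X Y; rewrite !subr0 => Xr Yr.
have [] := An (X, Y) (conj (Ar X Xr).1 (Ar Y Yr).2) => /= b1 b2.
rewrite /chart projB ?chart_free//.
have -> : F + X *m G - (F + Y *m G) = (X - Y) *m G.
  by rewrite opprD addrACA subrr add0r mulmxBl.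
rewrite /dchart !mulmxA; move: (X - Y) b1 b2 => Z b1 b2.
rewrite opprD addrACA -linearB /=.
apply: le_trans (ler_normD _ _) _; rewrite norm_trmx.
rewrite [e]splitr mulrDl lerD//.
  by have := b1 Z; rewrite !mulmxA.
by have := b2 Z; rewrite !mulmxA.
Qed.

End Chart.

(** * The dimension count against symmetric matrices *)

Section SymmetricRank.
Context {R : realType} {n : nat}.

Definition symmetrize (X : 'M[R]_n) := X + X^T.

Lemma symmetrize_linear : linear symmetrize.
Proof.
by move=> c X Y; rewrite /symmetrize linearD /= linearZ /= scalerDr addrACA.
Qed.
HB.instance Definition _ :=
  GRing.isLinear.Build R _ _ _ symmetrize symmetrize_linear.

(** Symmetrization maps onto the symmetric matrices, so this row space is the space of symmetric
    matrices. Its rank is compared with [k] and never evaluated. *)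
Definition sym_mx : 'M[R]_(n * n) := lin_mx symmetrize.

Lemma sub_sym_mx (X : 'M[R]_n) : (mxvec X <= sym_mx)%MS = (X^T == X).
Proof.
apply/idP/eqP => [/submxP[u uX]|Xs].
  have : mxvec X = mxvec (symmetrize (vec_mx u)).
    by rewrite uX -mul_vec_lin vec_mxK.
  move/(can_inj mxvecK) => ->; rewrite /symmetrize linearD /= trmxK.
  exact: addrC.
apply/submxP; exists (mxvec (2^-1 *: X)); rewrite mul_vec_lin /= /symmetrize.
rewrite linearZ /= Xs -scalerDl; congr mxvec.
by rewrite -[LHS]scale1r; congr (_ *: _); field.
Qed.

Context {k : nat} (f : {linear 'rV[R]_k -> 'M[R]_n}).
Hypothesis f_inj : forall w, f w = 0 -> w = 0.
Hypothesis f_sym : forall S, S^T = S -> exists w, f w = S.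

(** The image of [f] has dimension [k] and contains the symmetric matrices, so the two spaces agree
    exactly when their dimensions do. The right side mentions no base point, which allows symmetry
    to be carried from one Lagrangian subspace to another. *)
Lemma image_sym_rank : (forall w, (f w)^T = f w) <-> \rank sym_mx = k.
Proof.
pose m : 'M[R]_(k, n * n) := lin1_mx (mxvec \o f).
have mE w : w *m m = mxvec (f w) by rewrite mul_rV_lin1.
have rm : \rank m = k.
  apply/eqP/inj_row_free => w; rewrite mE => fw; apply: f_inj.
  by apply: (can_inj mxvecK); rewrite fw linear0.
have sm : (sym_mx <= m)%MS.
  apply/row_subP => i; have : (row i sym_mx <= sym_mx)%MS by exact: row_sub.
  rewrite -[row i sym_mx]vec_mxK sub_sym_mx => /eqP /f_sym[w <-].
  by rewrite -mE submxMl.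
split=> [fs|rk w].
  apply/eqP; rewrite eqn_leq -{1}rm mxrankS//=.
  rewrite -[in leqLHS]rm mxrankS//; apply/row_subP => i.
  by rewrite rowE mE sub_sym_mx fs.
have ms : (m <= sym_mx)%MS.
  by rewrite -(geq_leqif (mxrank_leqif_sup sm)) rm rk.
by apply/eqP; rewrite -sub_sym_mx -mE (submx_trans (submxMl _ _)).
Qed.

End SymmetricRank.

(** * The tangent space of M at a Lagrangian subspace *)

Section LocalModel.
Context {R : realType} {n k : nat}.
Local Notation E := 'M[R]_(n + n).
Context (Omega W : E) (F G : 'M[R]_(n, n + n)) (M : set E).
Hypotheses (Os : symplectic Omega) (D : darboux Omega W F G).
Hypotheses (LW : Lagrangian Omega W) (LM : Lagrangian Omega `<=` M).
Hypothesis MGr : M `<=` @Gr R n.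
Context (rho : E -> E) (a : {linear E -> 'rV[R]_k}) (b : {linear 'rV[R]_k -> E}).
Hypotheses (srho : strict_diff rho W (b \o a)) (abK : cancel b a).
Hypothesis nrho : \forall z \near W, M (rho z) /\ {for z, continuous rho}.
Hypothesis rhoK : \forall z \near W, M z -> rho z = z.
Let GrW : Gr W := LW.1.
Implicit Types (X Y Z S : 'M[R]_n) (v : E).

Local Notation coordB := (coordB Omega F).
Local Notation coordA := (coordA Omega F G).
Local Notation chart := (chart F G).
Local Notation dchart := (dchart W F G).

Lemma rho_ref : rho W = W.
Proof. exact: nbhs_singleton rhoK (LM LW). Qed.

(** The equations of [Gr] are differentiated along the points [rho (W + t *: v)] of M, whose
    difference quotients tend to [v] because [b \o a] fixes it. *)
Lemma image_tangent_Gr w : (b w)^T = b w /\ b w = b w *m W + W *m b w.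
Proof.
set v := b w; have [Ws Wi _] := GrW.
pose q t := t^-1 *: (rho (W + t *: v) - rho W).
have qv : q t @[t --> (0 : R)^'] --> v.
  have := @strict_diff_cvg _ _ _ _ _ (b \o a : {linear E -> E}) v srho.
  by rewrite /= abK.
have nq : \forall t \near (0 : R)^', Gr (W + t *: q t) /\ t != 0.
  have nG : \forall t \near (0 : R)^', M (rho (W + t *: v)).
    have nM : \forall z \near W, M (rho z) by apply: filterS nrho => z [].
    exact: (@cvg_line _ _ W v _ nM).
  apply: filterS2 nG (nbhs_dnbhs_neq (0 : R)) => t Mt t0.
  split=> //; rewrite /q scalerA mulfV// scale1r rho_ref addrC subrK.
  exact: MGr.
have tlim : t @[t --> (0 : R)^'] --> (0 : R).
  by apply: cvg_within_filter; exact: cvg_id.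
split.
  have lim1 : (q t)^T @[t --> (0 : R)^'] --> v^T by exact: cvg_trmx.
  suff lim2 : (q t)^T @[t --> (0 : R)^'] --> v by exact: mx_cvg_unique lim1 lim2.
  apply: cvg_trans qv; apply: near_eq_cvg.
  apply: filterS nq => t [[ts _ _] t0].
  have : t *: (q t)^T = t *: q t.
    apply: (@addrI _ W); rewrite -[RHS]ts.
    by rewrite [RHS]linearD /= Ws [in RHS]linearZ /=.
  by move/(scalerI t0).
(* Idempotence of [W + t *: q t], divided by [t], says that this expression equals [q t]. *)
have lim2 : q t *m W + W *m q t + t *: (q t *m q t) @[t --> (0 : R)^'] -->
    v *m W + W *m v + 0 *: (v *m v).
  apply: cvgD; first by apply: cvgD; apply: cvg_mulmx => //; exact: cvg_cst.
  by apply: cvgZ => //; exact: cvg_mulmx.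
rewrite scale0r addr0 in lim2.
suff lim3 : q t @[t --> (0 : R)^'] --> v *m W + W *m v.
  exact: mx_cvg_unique qv lim3.
apply: cvg_trans lim2; apply: near_eq_cvg.
apply: filterS nq => t [[_ ti _] t0].
move: (q t) ti => u ti; apply: (scalerI t0); apply: (@addrI _ W).
rewrite -[RHS]ti mulmxDl !mulmxDr Wi -!scalemxAr -!scalemxAl !scalerDr.
rewrite -!addrA; congr (_ + _); rewrite [LHS]addrCA; by [].
Qed.

Lemma dchart_coordB_image w : dchart (coordB (b w)) = b w.
Proof.
by have [vs vE] := image_tangent_Gr w; exact: (dchart_coordB Os D GrW vs vE).
Qed.

Lemma strict_rho_chart : strict_diff (rho \o chart) 0 ((b \o a) \o dchart).
Proof.
have [C C0 Cb] := mx_linear_bounded (b \o a : {linear E -> E}).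
have s0 : strict_diff rho (chart 0) (b \o a) by rewrite (chart0 D GrW).
exact: (@strict_diff_comp _ _ _ _ _ chart rho 0 (dchart : {linear _ -> _})
  (b \o a : {linear E -> E}) C C0 Cb (chart_strict D GrW) s0).
Qed.

Lemma near_chart (Q : set E) : (\forall z \near W, Q z) ->
  \forall X \near (0 : 'M[R]_n), Q (chart X).
Proof.
have c : chart X @[X --> (0 : 'M[R]_n)] --> chart 0.
  exact: (@cvg_chart _ _ _ _ _ _ D _ (nbhs (0 : 'M[R]_n)) (nbhs_filter _) id 0
    (fun _ => id)).
by rewrite (chart0 D GrW) in c => QW; exact: (c _ QW).
Qed.

(** Lagrangian charts at small multiples of [S] lie in M and are fixed by [rho], so [chart] and
    [rho \o chart] have the same derivative along [S]. *)
Lemma image_dchart_sym S : S^T = S -> b (a (dchart S)) = dchart S.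
Proof.
move=> Ss.
have l1 := @strict_diff_cvg _ _ _ _ _
  ((b \o a) \o dchart : {linear 'M[R]_n -> E}) S strict_rho_chart.
have l2 := @strict_diff_cvg _ _ _ _ _ (dchart : {linear 'M[R]_n -> E}) S
  (chart_strict D GrW).
suff l3 : t^-1 *: ((rho \o chart) (0 + t *: S) - (rho \o chart) 0)
    @[t --> (0 : R)^'] --> dchart S by exact: mx_cvg_unique l1 l3.
apply: cvg_trans l2; apply: near_eq_cvg.
have nr : \forall t \near (0 : R)^', M (chart (0 + t *: S)) ->
    rho (chart (0 + t *: S)) = chart (0 + t *: S).
  exact: (@cvg_line _ _ 0 S _ (near_chart rhoK)).
apply: filterS nr => t rt /=.
rewrite rt; last first.
  by apply: LM; apply: (chart_Lagrangian Os D); rewrite add0r linearZ /= Ss.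
by rewrite (chart0 D GrW) rho_ref.
Qed.

Lemma strict_coordB_rho_chart :
  strict_diff (coordB \o (rho \o chart)) 0 (coordB \o ((b \o a) \o dchart)).
Proof.
have [C C0 Cb] := mx_linear_bounded (coordB : {linear E -> 'M[R]_n}).
exact: (@strict_diff_comp _ _ _ _ _ (rho \o chart) coordB 0
  ((b \o a) \o dchart : {linear _ -> _}) (coordB : {linear E -> 'M[R]_n})
  C C0 Cb strict_rho_chart (strict_diff_linear _ _)).
Qed.

Lemma strict_coordB_chart : strict_diff (coordB \o chart) 0 id.
Proof.
have [C C0 Cb] := mx_linear_bounded (coordB : {linear E -> 'M[R]_n}).
have := @strict_diff_comp _ _ _ _ _ chart coordB 0
  (dchart : {linear _ -> _}) (coordB : {linear E -> 'M[R]_n})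
  C C0 Cb (chart_strict D GrW) (strict_diff_linear _ _).
by rewrite (_ : coordB \o dchart = id)//; apply/funext => Z /=;
  rewrite (coordB_dchart Os D GrW).
Qed.

Lemma image_rank_sym :
  (forall w, (coordB (b w))^T = coordB (b w)) <-> \rank (@sym_mx R n) = k.
Proof.
apply: (image_sym_rank (f := (coordB \o b : {linear 'rV[R]_k -> 'M[R]_n}))).
  move=> w /= bw; rewrite -[w]abK -dchart_coordB_image bw !linear0.
  by [].
move=> S Ss; exists (a (dchart S)) => /=.
by rewrite image_dchart_sym// (coordB_dchart Os D GrW).
Qed.

(* The skew part of the chart has derivative 0 along M, hence Lipschitz constant
   less than 1; comparing a point of M with its symmetric part, which is
   Lagrangian and so also in M, shows that its skew part is 0. *)
Lemma near_Lagrangian : (forall w, (coordB (b w))^T = coordB (b w)) ->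
  \forall z \near W, M z -> Lagrangian Omega z.
Proof.
move=> bsym.
(* Two errors of one quarter place the skew matrix [Z] within half of its norm of the symmetric
   matrix [sig]. Subtracting the transpose cancels [sig] and gives [2 |Z| <= |Z|]. *)
have e0 : (0 : R) < 4^-1 by rewrite invr_gt0.
have [r1 r10 s1] := strict_coordB_rho_chart e0.
have [r2 r20 s2] := strict_coordB_chart e0.
have [r3 r30 s3] := cvg_near0_norm (near_chart rhoK).
pose r := Num.min r1 (Num.min r2 r3).
have r0 : 0 < r by rewrite !lt_min r10 r20.
have FW : Filter (nbhs W) by exact: nbhs_filter.
have cA : coordA z @[z --> W] --> (1%:M : 'M[R]_n).
  rewrite -(coordA_ref D GrW).
  by do 2!(apply: cvg_mulmx; last exact: cvg_cst); apply: cvg_mulmx => [|A];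
    first exact: cvg_cst.
have cX : invmx (coordA z) *m coordB z @[z --> W] --> (0 : 'M[R]_n).
  rewrite -[X in _ --> X](mulmx0 _ (invmx 1%:M)) -(coordB_ref D GrW).
  apply: cvg_mulmx; first by apply: cvg_invmx => //; exact: unitmx1.
  apply: cvgN.
  by do 2!(apply: cvg_mulmx; last exact: cvg_cst); apply: cvg_mulmx => [|A];
    first exact: cvg_cst.
have nA : \forall z \near W, coordA z \in unitmx.
  exact: (near_unitmx cA (unitmx1 _ _)).
have nX : \forall z \near W, `|invmx (coordA z) *m coordB z| < r.
  move/cvgrPdist_lt : cX => /(_ _ r0); apply: filterS => z.
  by rewrite sub0r normrN.
near=> z => Mz.
have zu : coordA z \in unitmx by near: z.
have Xr : `|invmx (coordA z) *m coordB z| < r by near: z.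
have rz : rho z = z by move: Mz; near: z.
have zE := chart_surj Os D (MGr Mz) zu; move: rz Mz.
rewrite zE; move: (invmx _ *m _) Xr => X Xr {zE zu} rX MX.
pose S := 2^-1 *: (X + X^T); pose Z := 2^-1 *: (X - X^T).
have ST : S^T = S by rewrite /S linearZ /= linearD /= trmxK addrC.
have ZT : Z^T = - Z by rewrite /Z linearZ /= linearB /= trmxK -scalerN opprB.
have XSZ : X - S = Z by apply/matrixP => i j; rewrite !mxE; field.
have Sr : `|S| < r.
  apply: le_lt_trans Xr; rewrite normrZ gtr0_norm ?invr_gt0//.
  rewrite ler_pdivrMl//; apply: le_trans (ler_normD _ _) _.
  by rewrite norm_trmx mulr_natl mulr2n.
have LS : Lagrangian Omega (chart S) by exact: (chart_Lagrangian Os D).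
have rS : rho (chart S) = chart S.
  apply: s3; last exact: LM.
  by move: Sr; rewrite !lt_min => /and3P[].
suff Z0 : Z = 0 by move/eqP: XSZ; rewrite Z0 subr_eq0 => /eqP ->.
move: Sr Xr; rewrite !lt_min => /and3P[S1 S2 _] /and3P[X1 X2 _].
have := s1 X S; rewrite !subr0 XSZ => /(_ X1 S1) /=; rewrite rX rS.
have := s2 X S; rewrite !subr0 XSZ => /(_ X2 S2) /=.
have sigT := bsym (a (dchart Z)); move: (coordB (b _)) sigT => sig sigT.
move: (coordB (chart X) - coordB (chart S)) => Y YZ Ysig.
have q2 : `|Z - sig| <= 2^-1 * `|Z|.
  have -> : Z - sig = (Y - sig) - (Y - Z).
    by rewrite opprB [RHS]addrC subrKA.
  apply: le_trans (ler_normB _ _) _; apply: le_trans (lerD Ysig YZ) _.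
  by rewrite -mulrDl ler_wpM2r//; lra.
have : `|2 *: Z| <= `|Z|.
  have -> : 2 *: Z = (Z - sig) - (Z - sig)^T.
    rewrite linearB /= ZT sigT opprB opprK subrKA.
    by rewrite scaler_nat mulr2n.
  apply: le_trans (ler_normB _ _) _; rewrite norm_trmx.
  by apply: le_trans (lerD q2 q2) _; rewrite -mulrDl; lra.
rewrite normrZ gtr0_norm// => Z2; apply/eqP; rewrite -normr_le0.
have := normr_ge0 Z; lra.
Unshelve. all: by end_near. Qed.

End LocalModel.

(** * Existence of a nonsymmetric tangent matrix *)

Section NonSymmetric.
Context {R : realType} {n k : nat}.
Local Notation E := 'M[R]_(n + n).
Context (Omega P : E) (F G : 'M[R]_(n, n + n)) (M : set E).
Hypotheses (Os : symplectic Omega) (D : darboux Omega P F G).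
Hypotheses (LP : Lagrangian Omega P) (LM : Lagrangian Omega `<=` M).
Hypotheses (MGr : M `<=` @Gr R n) (Mc : connected M).
Hypotheses (Msub : smooth_submanifold k M) (LneM : Lagrangian Omega <> M).
Context (rho : E -> E) (a : {linear E -> 'rV[R]_k}) (b : {linear 'rV[R]_k -> E}).
Hypotheses (srho : strict_diff rho P (b \o a)) (abK : cancel b a).
Hypothesis nrho : \forall z \near P, M (rho z) /\ {for z, continuous rho}.
Hypothesis rhoK : \forall z \near P, M z -> rho z = z.

Lemma closed_isotropic : closed [set V : E | V *m Omega *m V^T = 0].
Proof.
have c : continuous (fun V : E => V *m Omega *m V^T).
  move=> V; have FV : Filter (nbhs V) by exact: nbhs_filter.
  apply: cvg_mulmx; last by apply: cvg_trmx => A.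
  by apply: cvg_mulmx; [move=> A|exact: cvg_cst].
rewrite (_ : [set _ | _] = (fun V : E => V *m Omega *m V^T) @^-1` [set 0])//.
apply: closed_comp => [V _|]; first exact: c.
apply: accessible_closed_set1; apply: hausdorff_accessible.
exact: norm_hausdorff.
Qed.

Lemma nonsymmetric_tangent :
  exists w, (coordB Omega F (b w))^T <> coordB Omega F (b w).
Proof.
apply: contra_notP LneM => /forallNP bsym.
have {}bsym w : (coordB Omega F (b w))^T = coordB Omega F (b w).
  exact: contrapT (bsym w).
(* This equality concerns [k] alone and is reused below at every Lagrangian [W], with its own frame
   and retraction. *)
have rk := (image_rank_sym Os D LP LM MGr srho abK nrho rhoK).1 bsym.
have Lopen W : Lagrangian Omega W ->
    \forall z \near W, M z -> Lagrangian Omega z.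
  move=> LW; have [F' [G' D']] := darboux_exists Os LW.
  have [rho' [a' [b' [s' ab' n' r']]]] := submanifold_retraction Msub (LM LW).
  apply: (near_Lagrangian Os D' LW LM MGr s' r').
  exact: (image_rank_sym Os D' LW LM MGr s' ab' n' r').2.
(* Relative openness and closedness are witnessed by ambient sets: the interior of an implication,
   and the isotropy equation, which cuts out Lambda(n) within [Gr]. *)
apply: Mc; first by exists P.
  exists [set z | M z -> Lagrangian Omega z]°; first exact: open_interior.
  apply/seteqP; split=> [W LW|W [MW nW]].
    by split; [exact: LM|exact: Lopen].
  exact: (nbhs_singleton nW MW).
exists [set V : E | V *m Omega *m V^T = 0]; first exact: closed_isotropic.
apply/seteqP; split=> [W LW|W [MW OW]]; last by split=> //; exact: MGr.
by split; [exact: LM|case: LW].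
Qed.

End NonSymmetric.

(** * Normal form of a nonsymmetric tangent matrix *)

Section FrameChange.
Context {R : realType} {n : nat}.
Local Notation E := 'M[R]_(n + n).
Implicit Types (Omega W v : E) (F G : 'M[R]_(n, n + n)) (X : 'M[R]_n).

Lemma darboux_perm Omega W F G (s : 'S_n) : darboux Omega W F G ->
  darboux Omega W (perm_mx s *m F) (perm_mx s *m G).
Proof.
move=> [Ff FW FF FG GG].
have su : row_full (perm_mx s : 'M[R]_n) by rewrite row_full_unit unitmx_perm.
have conj H K : (perm_mx s *m H) *m Omega *m (perm_mx s *m K)^T =
    perm_mx s *m (H *m Omega *m K^T) *m (perm_mx s)^T.
  by rewrite trmx_mul !mulmxA.
have sF := eqmxMfull F su.
split; rewrite ?conj ?FF ?GG ?FG ?mulmx0 ?mul0mx//.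
- by rewrite /row_free sF.
- exact: eqmx_trans sF FW.
- by rewrite mulmx1 tr_perm_mx -perm_mxM mulgV perm_mx1.
Qed.

Lemma coordB_perm Omega F (s : 'S_n) v i j :
  coordB Omega (perm_mx s *m F) v i j = coordB Omega F v (s i) (s j).
Proof.
rewrite /coordB trmx_mul -!mulmxA.
rewrite [in LHS]mxE [in RHS]mxE; congr (- _).
rewrite !mulmxA tr_perm_mx -col_permE -!mulmxA -row_permE.
by rewrite !mxE.
Qed.

End FrameChange.

Lemma perm_pair (m : nat) (i j : 'I_m.+2) : i != j ->
  exists s : 'S_m.+2, s ord0 = i /\ s (lift ord0 ord0) = j.
Proof.
move=> ij; pose one : 'I_m.+2 := lift ord0 ord0.
pose t := tperm ord0 i.
have tj0 : t j != ord0.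
  by rewrite -(inj_eq (@perm_inj _ t)) tpermK tpermL eq_sym.
exists (tperm one (t j) * t)%g; rewrite !permM; split.
  by rewrite [tperm one _ _]tpermD// /t tpermL.
by rewrite tpermL tpermK.
Qed.

Section LowerTangent.
Context {R : realType} {m k : nat}.
Local Notation n := m.+2.
Local Notation E := 'M[R]_(n + n).
Context (Omega P : E) (F G : 'M[R]_(n, n + n)) (M : set E).
Hypotheses (Os : symplectic Omega) (D : darboux Omega P F G).
Hypotheses (LP : Lagrangian Omega P) (LM : Lagrangian Omega `<=` M).
Hypotheses (MGr : M `<=` @Gr R n).
Context (rho : E -> E) (a : {linear E -> 'rV[R]_k}) (b : {linear 'rV[R]_k -> E}).
Hypotheses (srho : strict_diff rho P (b \o a)) (abK : cancel b a).
Hypothesis nrho : \forall z \near P, M (rho z) /\ {for z, continuous rho}.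
Hypothesis rhoK : \forall z \near P, M z -> rho z = z.

(** A permutation of the frame moves a nonzero skew entry to the first two indices and scaling makes
    it 1. Adding a symmetric matrix, which is always tangent, replaces the skew matrix by twice its
    strictly lower part. *)
Lemma lower_tangent w : (coordB Omega F (b w))^T <> coordB Omega F (b w) ->
  exists (F' G' : 'M[R]_(n, n + n)) (L : 'M[R]_n),
  [/\ darboux Omega P F' G', forall i j : 'I_n, (i <= j)%N -> L i j = 0,
      L (lift ord0 ord0) ord0 = 1 &
      b (a (dchart P F' G' L)) = dchart P F' G' L].
Proof.
set N := coordB Omega F (b w) => NT.
have [i [j Nij]] : exists i j, N i j != N j i.
  apply: contra_notP NT => /forallNP H; apply/matrixP => i j; rewrite mxE.
  have /forallNP/(_ i)/negP := H j; rewrite negbK => /eqP //.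
have ij : i != j by apply: contraNneq Nij => ->.
have [s [s0 s1]] := perm_pair ij.
pose F' := perm_mx s *m F; pose G' := perm_mx s *m G.
have D' : darboux Omega P F' G' := darboux_perm s D.
pose N' := coordB Omega F' (b w).
pose c := N' (lift ord0 ord0) ord0 - N' ord0 (lift ord0 ord0).
have c0 : c != 0 by rewrite subr_eq0 eq_sym /N' !coordB_perm s0 s1.
pose A : 'M[R]_n := c^-1 *: (N' - N'^T).
pose L : 'M[R]_n := \matrix_(i, j) (if (i <= j)%N then 0 else A i j).
have AT i' j' : A j' i' = - A i' j' by rewrite !mxE -mulrN opprB.
have AL : L - L^T = A.
  have LE i' j' : L i' j' = if (i' <= j')%N then 0 else A i' j' by rewrite mxE.
  apply/matrixP => i' j'; rewrite [LHS]mxE [X in _ + X]mxE [X in - X]mxE !LE.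
  case: (ltngtP i' j') => [_|_|/val_inj ->].
  - by rewrite sub0r -AT.
  - by rewrite subr0.
  - have := AT j' j'; move: (A j' j') => x; lra.
(* [fixd X] says that [X] is tangent to M in the chart of the new frame; it is a linear
   condition. *)
pose fixd X := b (a (dchart P F' G' X)) = dchart P F' G' X.
have fixed_sym S : S^T = S -> fixd S.
  exact: (image_dchart_sym Os D' LP LM srho rhoK).
have fixedD X Y : fixd X -> fixd Y -> fixd (X + Y).
  rewrite /fixd => fX fY.
  by rewrite (linearD (dchart P F' G')) (linearD a) (linearD b) /= fX fY.
have fixedZ (x : R) X : fixd X -> fixd (x *: X).
  rewrite /fixd => fX.
  by rewrite (linearZZ (dchart P F' G')) (linearZZ a) (linearZZ b) fX.
have fixedN : fixd N'.
  rewrite /fixd (dchart_coordB_image Os D' LP LM MGr srho abK nrho rhoK).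
  by rewrite abK.
have fixedA : fixd A.
  have -> : A = (2 * c^-1) *: N' + (- c^-1) *: (N' + N'^T).
    by apply/matrixP => i' j'; rewrite !mxE; field.
  apply: fixedD; apply: fixedZ => //; apply: fixed_sym.
  by rewrite linearD /= trmxK addrC.
exists F', G', L; split=> //.
- by move=> i' j' ij'; rewrite mxE ij'.
- rewrite mxE /= /A.
  have -> (X : 'M[R]_n) (x : R) i' j' :
      (x *: (X - X^T)) i' j' = x * (X i' j' - X j' i') by rewrite !mxE.
  by rewrite -/c mulVf.
have -> : L = 2^-1 *: A + 2^-1 *: (L + L^T).
  by rewrite -AL; apply/matrixP => i' j'; rewrite !mxE; field.
apply: fixedD; apply: fixedZ => //; apply: fixed_sym.
by rewrite linearD /= trmxK addrC.
Qed.

End LowerTangent.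

(** * The path of corank one matrices near the reference subspace *)

Section ModelPath.
Context {R : realType} {m : nat}.
Local Notation n := m.+2.
Local Notation i0 := (@ord0 m.+1).
Local Notation i1 := (lift (@ord0 m.+1) (@ord0 m)).
Context (L : 'M[R]_n).
Hypotheses (L0 : forall i j : 'I_n, (i <= j)%N -> L i j = 0) (L1 : L i1 i0 = 1).

Definition model_diag (a b c : R) : 'M[R]_n :=
  \matrix_(i, j) (if i == j then
    (if i == i0 then a else if i == i1 then b else c) else 0).

(** This correction is symmetric, hence tangent to Lambda(n), and crosses the determinant
    hypersurface in the same sense for all [t]. At [t = 1] and [t = -1] it is a matrix unit and its
    opposite: this sign is the source of the contradiction. *)
Definition model_dir (t : R) : 'M[R]_n :=
  t *: delta_mx i1 i1 - (1 - t ^+ 2) *: (delta_mx i0 i1 + delta_mx i1 i0).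

(* With w = 1 - t^2, the leading 2 x 2 block of model_path t y is
   [t, - y w; w - y w, y t], the block to its right is 0 and the last diagonal
   block is lower unitriangular. At y = 0 the matrix has corank 1 and its left
   kernel makes a half turn as t goes from 1 to -1. *)
Definition model_path (t y : R) : 'M[R]_n :=
  model_diag t 0 1 + (1 - t ^+ 2) *: L + y *: model_dir t.

Lemma model_diag_sym a b c : (model_diag a b c)^T = model_diag a b c.
Proof.
by apply/matrixP => i j; rewrite !mxE eq_sym; case: eqP => // ->.
Qed.

Lemma model_dir_sym t : (model_dir t)^T = model_dir t.
Proof.
rewrite /model_dir linearB /= !linearZ /= linearD /= !trmx_delta.
by rewrite [delta_mx i0 i1 + _]addrC.
Qed.

Lemma det_block_trig p q (A : 'M[R]_(p + q)) :
  ursubmx A = 0 ->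
  (forall i j : 'I_q, (i < j)%N -> A (rshift p i) (rshift p j) = 0) ->
  (forall i : 'I_q, A (rshift p i) (rshift p i) = 1) ->
  \det A = \det (ulsubmx A).
Proof.
move=> A0 trig diag; rewrite -{1}[A]submxK A0 det_lblock.
rewrite [\det (drsubmx _)]det_trig; last first.
  by apply/is_trig_mxP => i j ij; rewrite !mxE trig.
by rewrite big1 ?mulr1// => i _; rewrite !mxE diag.
Qed.

Lemma det_mx2 (A : 'M[R]_2) :
  \det A = A ord0 ord0 * A ord_max ord_max - A ord0 ord_max * A ord_max ord0.
Proof.
rewrite (expand_det_row _ ord0) !big_ord_recl big_ord0 addr0 /cofactor.
rewrite !det_mx11 !mxE /= expr0 expr1 mul1r mulN1r mulrN.
by congr (_ * A _ _ - A _ _ * A _ _); apply/val_inj.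
Qed.

Lemma det_model t y : \det (model_path t y) =
  y * t ^+ 2 + y * (1 - y) * (1 - t ^+ 2) ^+ 2.
Proof.
have E i j : model_path t y i j =
    (if i == j then (if i == i0 then t else if i == i1 then 0 else 1) else 0) +
    (1 - t ^+ 2) * L i j +
    y * (t * ((i == i1) && (j == i1))%:R -
     (1 - t ^+ 2) * (((i == i0) && (j == i1))%:R + ((i == i1) && (j == i0))%:R)).
  by rewrite !mxE.
have ul (A : 'M[R]_(2 + m)) i j : ulsubmx A i j = A (lshift m i) (lshift m j).
  by rewrite !mxE.
have ur (A : 'M[R]_(2 + m)) i j : ursubmx A i j = A (lshift m i) (rshift 2 j).
  by rewrite !mxE.
rewrite (@det_block_trig 2 m (model_path t y)).
- rewrite det_mx2 !ul !E.
  rewrite (_ : lshift m (ord0 : 'I_2) = i0 :> 'I_(2 + m)); last exact/val_inj.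
  rewrite (_ : lshift m (ord_max : 'I_2) = i1 :> 'I_(2 + m)); last exact/val_inj.
  rewrite -!val_eqE /= L1 !(L0 (leqnn _)) (L0 (i := i0) (j := i1))//.
  ring.
- apply/matrixP => i j; rewrite ur [RHS]mxE E L0; last first.
    by rewrite /= (leq_trans (ltnW (ltn_ord i)))// leq_addr.
  rewrite -!val_eqE /= !add2n; case: i => [[|[|i]] //= _]; rewrite ?andbF /=; ring.
- move=> i j ij; rewrite E L0; last by rewrite /= leq_add2l ltnW.
  by rewrite -!val_eqE /= eqn_add2l (ltn_eqF ij); ring.
- move=> i; rewrite E L0 ?leqnn// eqxx.
  rewrite -!val_eqE /=; ring.
Qed.

(** By Jacobi's formula the trace is the derivative at [y = 0] of the polynomial in [det_model], so
    the adjugate need not be computed. *)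
Lemma tr_model t : \tr (\adj (model_path t 0) *m model_dir t) =
  t ^+ 2 + (1 - t ^+ 2) ^+ 2.
Proof.
pose w := (1 - t ^+ 2) ^+ 2.
pose p : {poly R} := (t ^+ 2 + w)%:P * 'X - w%:P * 'X^2.
have Dp := is_derive_poly p 0.
have Dd := is_derive_det_line (model_diag t 0 1 + (1 - t ^+ 2) *: L)
  (model_dir t) 0.
have pE : horner p = fun c : R => \det (model_diag t 0 1 +
    (1 - t ^+ 2) *: L + c *: model_dir t).
  apply/funext => c; rewrite -[in RHS]/(model_path t c) det_model /p.
  rewrite !(hornerD, hornerN, hornerM, hornerC, hornerX, hornerXn).
  rewrite /w; ring.
rewrite -[LHS](@derive_val _ _ _ _ _ _ _ Dd) -pE (@derive_val _ _ _ _ _ _ _ Dp).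
rewrite /p derivB !derivM !derivC !derivX ?derivXn.
rewrite !(hornerD, hornerN, hornerM, hornerC, hornerX, hornerMn).
rewrite /w; ring.
Qed.

Lemma tr_model_gt t : 2^-1 < \tr (\adj (model_path t 0) *m model_dir t).
Proof. by rewrite tr_model; nra. Qed.

Lemma norm_model_dir t : -1 <= t <= 1 -> `|model_dir t| <= 1.
Proof.
move=> /andP[t0 t1]; apply: mx_norm_le => // i j; rewrite !mxE.
have w0 : 0 <= 1 - t ^+ 2 by nra.
have w1 : 1 - t ^+ 2 <= 1 by nra.
have n1 : (`|t| <= 1) /\ (`|- (1 - t ^+ 2)| <= 1).
  by rewrite !ler_norml; split; apply/andP; split; lra.
have [->|ni] := eqVneq i i1; have [->|nj] := eqVneq j i1 => /=;
  [| case: (j == i0) | case: (i == i0) | ];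
  rewrite ?andbF /= ?(mulr0, mulr1, addr0, add0r, subr0, sub0r) ?oppr0 ?normr0 //;
  by case: n1.
Qed.

Lemma norm_model_path t y : -1 <= t <= 1 -> `|y| <= 1 ->
  `|model_path t y| <= 2 + `|L|.
Proof.
move=> t01 y1; have /andP[t0 t1] := t01.
have w1 : `|1 - t ^+ 2| <= 1 by rewrite ler_norml; apply/andP; split; nra.
apply: le_trans (ler_normD _ _) _; rewrite -[2]/(1 + 1) addrAC lerD//.
  apply: le_trans (ler_normD _ _) _; rewrite lerD//.
    apply: mx_norm_le => // i j; rewrite mxE.
    case: ifP => _; last by rewrite normr0.
    case: ifP => _; first by rewrite ler_norml t0.
    by case: ifP => _; rewrite ?normr0 ?normr1.
  by rewrite normrZ ler_piMl.
by rewrite normrZ mulr_ile1// norm_model_dir.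
Qed.

Lemma cvg_model_dir (T : Type) (FT : set_system T) (FF : Filter FT)
    (f : T -> R) (t : R) :
  f @ FT --> t -> model_dir (f x) @[x --> FT] --> model_dir t.
Proof.
move=> ft; apply: cvgB; first by apply: cvgZr_tmp.
apply: cvgZr_tmp; apply: cvgB; first exact: cvg_cst.
by rewrite expr2; under eq_fun do rewrite expr2; exact: cvgM.
Qed.

Lemma cvg_model_path (T : Type) (FT : set_system T) (FF : Filter FT)
    (f g : T -> R) (t y : R) : f @ FT --> t -> g @ FT --> y ->
  model_path (f x) (g x) @[x --> FT] --> model_path t y.
Proof.
move=> ft gy; apply: cvgD; last by apply: cvgZ => //; exact: cvg_model_dir.
apply: cvgD.
  apply: cvg_mx => i j; rewrite mxE; under eq_fun do rewrite mxE.
  case: ifP => _; last exact: cvg_cst.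
  by case: ifP => _; [|case: ifP => _; exact: cvg_cst].
apply: cvgZr_tmp; apply: cvgB; first exact: cvg_cst.
by rewrite expr2; under eq_fun do rewrite expr2; exact: cvgM.
Qed.

(** Compactness of [-1, 1] turns joint limits above [c] into one neighbourhood that serves all
    [t]. *)
Lemma segment_near (T : Type) (FT : set_system T) (FF : Filter FT)
    (psi : R -> T -> R) (c : R) :
  (forall t : R, -1 <= t <= 1 -> exists2 l, c < l &
     psi p.1 p.2 @[p --> (nbhs t, FT)] --> l) ->
  \forall z \near FT, forall t, -1 <= t <= 1 -> c < psi t z.
Proof.
move=> psic.
have := (compact_near_coveringP _).1 (@segment_compact R (-1) 1) T FT
  (fun z t => c < psi t z) FF.
have K t : `[-1, 1]%classic t <-> -1 <= t <= 1 by rewrite /= in_itv.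
move=> H; apply: filterS (H _) => [z Hz t /K t01|t /K /psic[l cl] pl].
  exact: Hz.
by move/cvgr_gt : pl => /(_ _ cl).
Qed.

(** All perturbations are allowed at once because the bound serves twice: with [A] the identity for
    the slope of the determinant, and with [A] the matrix [coordA] for transversality to the
    train. *)
Lemma model_uniform_trace : exists2 d : R, 0 < d <= 1 &
  forall t y (e q A : 'M[R]_n), -1 <= t <= 1 ->
    `|y| <= d -> `|e| <= d -> `|q| <= d -> `|A - 1%:M| <= d ->
    2^-1 < \tr (\adj (model_path t y + e) *m (A *m (model_dir t + q))).
Proof.
pose psi (t : R) (z : (R * 'M[R]_n) * ('M[R]_n * 'M[R]_n)) :=
  \tr (\adj (model_path t z.1.1 + z.1.2) *m (z.2.2 *m (model_dir t + z.2.1))).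
pose z0 : (R * 'M[R]_n) * ('M[R]_n * 'M[R]_n) := ((0, 0), (0, 1%:M)).
have : \forall z \near nbhs z0, forall t, -1 <= t <= 1 -> 2^-1 < psi t z.
  apply: segment_near => t t01; exists (psi t z0).
    by rewrite /psi /= addr0 addr0 mul1mx tr_model_gt.
  set FP := (nbhs t, nbhs z0).
  have c1 : p.1 @[p --> FP] --> t by exact: cvg_fst.
  have c2 : p.2 @[p --> FP] --> z0 by exact: cvg_snd.
  pose Z : Type := R * ((R * 'M[R]_n) * ('M[R]_n * 'M[R]_n)).
  have cp1 (U V : topologicalType) (f : Z -> U * V) (x : U * V) :
      f @ FP --> x -> (f p).1 @[p --> FP] --> x.1.
    move=> fx; apply: (@cvg_comp _ _ _ f fst); first exact: fx.
    by case: x {fx} => *; exact: cvg_fst.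
  have cp2 (U V : topologicalType) (f : Z -> U * V) (x : U * V) :
      f @ FP --> x -> (f p).2 @[p --> FP] --> x.2.
    move=> fx; apply: (@cvg_comp _ _ _ f snd); first exact: fx.
    by case: x {fx} => *; exact: cvg_snd.
  have c21 := cp1 _ _ _ _ c2; have c22 := cp2 _ _ _ _ c2.
  apply: cvg_mxtrace; apply: cvg_mulmx.
    apply: cvg_adj; apply: cvgD; last exact: cp2 c21.
    by apply: cvg_model_path => //; exact: cp1 c21.
  apply: cvg_mulmx; first exact: cp2 c22.
  by apply: cvgD; [exact: cvg_model_dir|exact: cp1 c22].
move=> /nbhs_ballP[r /= r0 rball].
exists (Num.min 1 (r / 2)); first by rewrite lt_min ltr01 divr_gt0//= ge_min lexx.
have rr : r / 2 < r by rewrite ltr_pdivrMr// ltr_pMr// ltrDl.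
move=> t y e q A t01; rewrite !le_min.
move=> /andP[_ yr] /andP[_ er] /andP[_ qr] /andP[_ Ar].
apply: (rball ((y, e), (q, A)) _ t t01).
by split; split; rewrite -ball_normE /= ?sub0r ?normrN ?(distrC 1%:M);
  exact: le_lt_trans rr.
Qed.

Lemma model_uniform_det d : 0 < d -> exists2 d' : R, 0 < d' &
  forall t (e : 'M[R]_n), -1 <= t <= 1 -> `|e| <= d' ->
    `|\det (model_path t 0 + e)| < d.
Proof.
move=> d0.
(* The absolute value is negated because [segment_near] delivers lower bounds. *)
have : \forall e \near (0 : 'M[R]_n), forall t, -1 <= t <= 1 ->
    - d < - `|\det (model_path t 0 + e)|.
  apply: (@segment_near _ (nbhs (0 : 'M[R]_n)) (nbhs_filter _)) => t t01.
  exists (- `|\det (model_path t 0 + 0)|).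
    by rewrite addr0 det_model !mul0r addr0 normr0 oppr0 oppr_lt0.
  apply: cvgN; apply: cvg_norm; apply: cvg_det; apply: cvgD; last exact: cvg_snd.
  by apply: cvg_model_path; [exact: cvg_fst|exact: cvg_cst].
move=> /cvg_near0_norm[r r0 rH]; exists (r / 2); first by rewrite divr_gt0.
move=> t e t01 er; rewrite -ltrN2; apply: rH => //.
by apply: le_lt_trans er _; rewrite ltr_pdivrMr// ltr_pMr// ltrDl.
Qed.

End ModelPath.

(** * Continuous zeros and constancy of signs along paths *)

Section Paths.
Context {R : realType}.

(** The sign change gives a zero and strict monotonicity in [y] its uniqueness. Continuity follows
    from squeezing: the signs at two heights around the zero persist for nearby [t]. *)
Lemma implicit_path (F : R -> R -> R) (d : R) :
  (forall y, `|y| <= d -> continuous (F^~ y)) ->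
  (forall t, {within `[- d, d], continuous (F t)}) ->
  (forall t y z, `|y| <= d -> `|z| <= d -> y < z -> F t y < F t z) ->
  (forall t, F t (- d) < 0 /\ 0 < F t d) -> 0 < d ->
  exists f : R -> R, [/\ continuous f, forall t, `|f t| <= d,
    forall t, F t (f t) = 0 &
    forall t y, `|y| <= d -> F t y = 0 -> y = f t].
Proof.
move=> Ft Fy Fm Fd d0.
have dd : - d <= d by rewrite ge0_cp// ltW.
have uniq t y z : `|y| <= d -> `|z| <= d -> F t y = 0 -> F t z = 0 -> y = z.
  move=> yd zd y0 z0; apply/eqP; case: (ltgtP y z) => // yz.
    by have := Fm t _ _ yd zd yz; rewrite y0 z0 ltxx.
  by have := Fm t _ _ zd yd yz; rewrite y0 z0 ltxx.
have ex t : exists y, `|y| <= d /\ F t y = 0.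
  have [Fn Fp] := Fd t.
  have [|y yd Fy0] := @IVT R (F t) (- d) d 0 dd (Fy t).
    by rewrite ge_min le_max (ltW Fn) (ltW Fp) orbT.
  by exists y; rewrite ler_norml; move: yd; rewrite in_itv.
have [f fP] := choice ex.
exists f; split => [t|t|t|t y yd y0].
- apply/cvgrPdist_le => e e0.
  have [fd f0] := fP t; move: (fd); rewrite ler_norml => /andP[fd1 fd2].
  have fld : - d < f t.
    rewrite lt_neqAle fd1 andbT; apply/eqP => fE.
    by have := (Fd t).1; rewrite fE f0 ltxx.
  have fud : f t < d.
    rewrite lt_neqAle fd2 andbT; apply/eqP => fE.
    by have := (Fd t).2; rewrite -fE f0 ltxx.
  (* The two heights are clipped to [-d, d], where monotonicity is available. *)
  pose lo := Num.max (- d) (f t - e); pose hi := Num.min d (f t + e).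
  have lod : `|lo| <= d.
    by rewrite ler_norml le_max lexx ge_max dd/=; lra.
  have hid : `|hi| <= d.
    by rewrite ler_norml ge_min lexx le_min dd/= andbT; lra.
  have Flo : F t lo < 0.
    by rewrite -f0; apply: Fm => //; rewrite gt_max fld ltrBlDr ltrDl.
  have Fhi : 0 < F t hi.
    by rewrite -f0; apply: Fm => //; rewrite lt_min fud ltrDl.
  have nlo : \forall x \near t, F x lo < 0.
    by have /cvgr_lt := Ft lo lod t; apply.
  have nhi : \forall x \near t, 0 < F x hi.
    by have /cvgr_gt := Ft hi hid t; apply.
  apply: filterS2 nlo nhi => x xlo xhi; have [gd g0] := fP x.
  have lof : lo <= f x.
    rewrite leNgt; apply/negP => l.
    by have := Fm x _ _ gd lod l; rewrite g0 ltNge (ltW xlo).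
  have fhi : f x <= hi.
    rewrite leNgt; apply/negP => l.
    by have := Fm x _ _ hid gd l; rewrite g0 ltNge (ltW xhi).
  move: lof fhi; rewrite ge_max le_min => /andP[_ l1] /andP[_ l2].
  by rewrite ler_norml; lra.
- by case: (fP t).
- by case: (fP t).
- by case: (fP t) => fd f0; exact: uniq y0 f0.
Qed.

Lemma path_const (T : topologicalType) (A : set T) (o : T -> bool)
    (g : R -> T) : {within A, continuous o} -> continuous g ->
  (forall t, A (g t)) -> forall s t, o (g s) = o (g t).
Proof.
move=> oc gc Ag s t.
have loc x : \forall y \near x, o (g y) = o (g x).
  have : within A (nbhs (g x)) [set z | o z = o (g x)].
    have /subspace_continuousP/(_ (g x) (Ag x)) := oc.
    move=> /(_ [set o (g x)]); apply.
    by apply/principal_filterP.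
  move=> /(gc x) H; apply: (@filterS _ (nbhs x) _ _ _ _ H) => y Hy.
  exact: Hy (Ag y).
pose B := [set y | o (g y) = o (g s)].
have Bo : open B.
  rewrite openE => x Bx; rewrite /interior /=.
  by apply: filterS (loc x) => y oy; rewrite /B /= oy; exact: Bx.
have Bc : closed B.
  rewrite (_ : B = ~` [set y | o (g y) = ~~ o (g s)]).
    apply: open_closedC; rewrite openE => x Bx; rewrite /interior /=.
    by apply: filterS (loc x) => y oy; rewrite /B /= oy; exact: Bx.
  by apply/seteqP; split=> y; rewrite /B /=; case: (o (g y)); case: (o (g s)).
have Rc : connected [set: R] by apply/connected_intervalP.
have BT : B = setT.
  apply: Rc; first by exists s.
    by exists B => //; rewrite setTI.
  by exists B => //; rewrite setTI.
by have : B t by [rewrite BT].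
Qed.

End Paths.

(** * Normal vectors of the train in frames *)

Section NormalVectors.
Context {R : realType} {n : nat}.
Local Notation E := 'M[R]_(n + n).
Context (Omega P : E) (F G : 'M[R]_(n, n + n)).
Hypotheses (Os : symplectic Omega) (D : darboux Omega P F G).

(** The nonzero trace acts twice: it forces a nonzero adjugate, hence corank one, and it makes the
    vector transverse to the train. *)
Lemma frame_normal (M : set E) (H : 'M[R]_(n, n + n)) (S : 'M[R]_n) :
  row_free H -> \det (H *m Omega *m F^T) = 0 ->
  \tr (\adj (H *m Omega *m F^T) *m (H *m Omega *m G^T *m S)) != 0 ->
  M (proj H) ->
  normal_vectors M P (proj H, nfield Omega G S (proj H)).
Proof.
move=> Hf detH trH MH; split=> /=.
- split=> //; apply: (train1_frame Os D Hf detH).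
  by apply: contraNneq trH => ->; rewrite mul0mx mxtrace0.
- exact/nfield_tangent/proj_Gr.
- exact: (nfield_not_tangent Os D Hf detH trH).
Qed.

Lemma coordB_chart X :
  coordB Omega F (chart F G X) = coordA Omega F G (chart F G X) *m X.
Proof.
have Hf := chart_free D X.
have VH : (F *m chart F G X <= (F + X *m G)%R)%MS.
  apply: submx_trans (submxMl _ _) _.
  by rewrite /chart (proj_eqmx Hf) submx_refl.
have [C CE] := submxP VH.
have HF : (F + X *m G) *m Omega *m F^T = - X.
  by rewrite -(frame_coordF Os D 1%:M X) mul1mx.
have HG : (F + X *m G) *m Omega *m G^T = 1%:M.
  by rewrite -(frame_coordG D 1%:M X) mul1mx.
by rewrite /coordB /coordA CE -!(mulmxA C) HF HG mul1mx mulmxN opprK.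
Qed.

Lemma coorientation_opp (M : set E) o (V v : E) : coorientation M P o ->
  normal_vectors M P (V, v) -> o (V, - v) = ~~ o (V, v).
Proof.
move=> [_ rule] Vv; have [[tV _] _ _] := Vv.
have := rule V v 0 (-1) Vv (tangent0 tV).
rewrite oppr_eq0 oner_eq0 => /(_ isT).
by rewrite scaleN1r addr0 ltr0N1.
Qed.

Lemma coorientation_path (M : set E) o (V S : R -> 'M[R]_(n + n)) :
  coorientation M P o -> (forall t, normal_vectors M P (V t, S t)) ->
  continuous V -> continuous S -> forall s t, o (V s, S s) = o (V t, S t).
Proof.
move=> [oc _] nV cV cS s t.
apply: (path_const (g := fun t => (V t, S t)) oc) => // x.
exact: (cvg_pair (cV x) (cS x)).
Qed.

End NormalVectors.

(** * The two arcs and the contradiction *)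

Section InfinityArc.
Context {R : realType} {m : nat}.
Local Notation n := m.+2.
Local Notation E := 'M[R]_(n + n).
Local Notation i1 := (lift (@ord0 m.+1) (@ord0 m)).
Context (Omega P : E) (F G : 'M[R]_(n, n + n)) (M : set E).
Hypotheses (Os : symplectic Omega) (D : darboux Omega P F G).
Hypotheses (LM : Lagrangian Omega `<=` M).
Context (o : E * E -> bool) (co : coorientation M P o).
Context (e : R) (e0 : 0 < e).

Lemma det_model_diag (a b c : R) :
  \det (model_diag a b c : 'M[R]_n) = a * b * c ^+ m.
Proof.
rewrite det_trig; last first.
  by apply/is_trig_mxP => i j ij; rewrite mxE -val_eqE (ltn_eqF ij).
rewrite !big_ord_recl !mxE /= mulrA; congr (_ * _).
rewrite -[X in c ^+ X]card_ord -prodr_const; apply: eq_bigr => i _.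
by rewrite !mxE eqxx.
Qed.

Lemma model_diagZ (x a b c : R) :
  x *: (model_diag a b c : 'M[R]_n) = model_diag (x * a) (x * b) (x * c).
Proof.
apply/matrixP => i j; rewrite !mxE; case: ifP => _; last by rewrite mulr0.
by case: ifP => _; [|case: ifP].
Qed.

Lemma mul_model_diag (a b c a' b' c' : R) :
  (model_diag a b c : 'M[R]_n) *m model_diag a' b' c' =
  model_diag (a * a') (b * b') (c * c').
Proof.
apply/matrixP => i j; rewrite mxE (bigD1 i)//= big1 => [|k ki]; last first.
  by rewrite mxE eq_sym (negPf ki) mul0r.
rewrite !mxE eqxx addr0; case: (i == j); last by rewrite mulr0.
by case: (i == ord0); [|case: (i == i1)].
Qed.

Lemma delta_model_diag : (delta_mx i1 i1 : 'M[R]_n) = model_diag 0 1 0.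
Proof.
apply/matrixP => i j; rewrite !mxE; case: (eqVneq i j) => [<-|ij].
  by rewrite andbb; case: (eqVneq i i1) => [->|]//=; case: ifP.
by case: (eqVneq i i1) ij => [->|]//=; rewrite eq_sym => /negPf ->.
Qed.

Lemma trace_model_diag (a c x : R) :
  \tr (\adj (model_diag a 0 c : 'M[R]_n) *m model_diag 0 x 0) = a * x * c ^+ m.
Proof.
pose p : {poly R} := (a * x * c ^+ m)%:P * 'X.
have Dp := is_derive_poly p 0.
have Dd := is_derive_det_line (model_diag a 0 c : 'M[R]_n) (model_diag 0 x 0) 0.
have pE : horner p =
    fun y : R => \det ((model_diag a 0 c : 'M[R]_n) + y *: model_diag 0 x 0).
  apply/funext => y; rewrite model_diagZ.
  rewrite (_ : _ + _ = model_diag a (y * x) c) ?det_model_diag; last first.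
    apply/matrixP => i j; rewrite !mxE.
    case: (i == j); last by rewrite addr0.
    by case: (i == ord0); [|case: (i == i1)]; rewrite ?mulr0 ?addr0 ?add0r.
  by rewrite /p hornerM hornerC hornerX; ring.
have := @derive_val _ _ _ _ _ _ _ Dd; rewrite scale0r addr0 => <-.
rewrite -pE (@derive_val _ _ _ _ _ _ _ Dp).
by rewrite /p derivM derivC derivX !hornerE.
Qed.

(* The path of Lagrangian subspaces spanned by diag(x, 1, .., 1) F +
   diag(-e, 0, e, .., e) G, from x = 1 to x = -1. *)
Lemma infinity_arc :
  o (chart F G (e *: model_diag (-1) 0 1),
     nfield Omega G (- delta_mx i1 i1) (chart F G (e *: model_diag (-1) 0 1))) =
  o (chart F G (e *: model_diag 1 0 1),
     nfield Omega G (- delta_mx i1 i1) (chart F G (e *: model_diag 1 0 1))).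
Proof.
pose A (x : R) : 'M[R]_n := model_diag x 1 1.
pose B : 'M[R]_n := model_diag (- e) 0 e.
pose H x := A x *m F + B *m G.
(* [B] vanishes only at the index [i1], where [A x] has entry 1. At [x = 0] the matrix [A x] is
   singular and the path leaves the graph chart, yet the frame stays free. *)
have Hf x : row_free (H x).
  apply: inj_row_free => u uH.
  have uA : u *m A x = 0.
    by rewrite -(frame_coordG D (A x) B) !mulmxA uH !mul0mx.
  have uB : u *m B = 0.
    rewrite -[B]opprK -(frame_coordF Os D (A x) B) mulmxN !mulmxA uH.
    by rewrite !mul0mx oppr0.
  have diagE (a b c : R) i : (u *m (model_diag a b c : 'M[R]_n)) ord0 i =
      u ord0 i * (if i == ord0 then a else if i == i1 then b else c).
    rewrite mxE (bigD1 i)//= big1 ?addr0 => [|j ji]; first by rewrite mxE eqxx.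
    by rewrite mxE (negPf ji) mulr0.
  apply/rowP => i; rewrite [RHS]mxE.
  have := diagE x 1 1 i; rewrite uA mxE.
  have := diagE (- e) 0 e i; rewrite uB mxE.
  case: (i == ord0).
    move=> /esym/eqP; rewrite mulf_eq0 oppr_eq0 (gt_eqF e0) orbF.
    by move=> /eqP.
  by case: (i == i1) => _; rewrite mulr1.
have nrm x : normal_vectors M P
    (proj (H x), nfield Omega G (- delta_mx i1 i1) (proj (H x))).
  have HF : H x *m Omega *m F^T = model_diag e 0 (- e).
    rewrite (frame_coordF Os D) /B -scaleN1r model_diagZ.
    by rewrite !mulN1r opprK oppr0.
  have HG : H x *m Omega *m G^T *m (- delta_mx i1 i1) = model_diag 0 (-1) 0.
    rewrite (frame_coordG D) delta_model_diag -scaleN1r model_diagZ.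
    by rewrite mul_model_diag !mulr0 mulN1r mul1r.
  apply: (frame_normal Os D (Hf x)).
  - by rewrite HF det_model_diag mulr0 mul0r.
  - have en : e != 0 by rewrite gt_eqF.
    by rewrite HF HG trace_model_diag !mulf_neq0 ?expf_neq0 ?oppr_eq0 ?oner_eq0.
  - apply: LM; apply: (Lagrangian_frame Os D (Hf x)).
    rewrite !model_diag_sym !mul_model_diag !(mulrC _ (- e)).
    by rewrite !mulr0 !mul0r !mul1r !mulr1.
have cH : continuous (fun x => proj (H x)).
  move=> x; apply: cvg_proj; first exact: Hf.
  apply: cvgD; last exact: cvg_cst.
  apply: cvg_mulmx; last exact: cvg_cst.
  apply: cvg_mx => i j; rewrite mxE; under eq_fun do rewrite mxE.
  case: ifP => _; last exact: cvg_cst.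
  by case: ifP => _; [|case: ifP => _; exact: cvg_cst].
have cN : continuous (fun x => nfield Omega G (- delta_mx i1 i1) (proj (H x))).
  by move=> x; apply: cvg_nfield; [exact: cvg_cst|exact: cH].
have := coorientation_path co nrm cH cN 1 (-1).
have -> : proj (H 1) = chart F G (e *: model_diag (-1) 0 1).
  rewrite /H /chart /B model_diagZ mulrN1 mulr0 mulr1.
  rewrite (_ : A 1 = 1%:M) ?mul1mx//.
  apply/matrixP => i j; rewrite !mxE; case: ifP => _ //.
  by case: ifP => _ //; case: ifP.
have -> // : proj (H (-1)) = chart F G (e *: model_diag 1 0 1).
(* The change of basis [A (-1)] flips the sign of the first entry of [B], which brings the arc back
   into the chart at the other endpoint. *)
have -> : H (-1) = A (-1) *m (F + (e *: model_diag 1 0 1) *m G).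
  rewrite mulmxDr mulmxA model_diagZ mul_model_diag /H /B.
  by rewrite !(mulr1, mul1r, mulr0, mulN1r).
rewrite proj_lin ?(chart_free D)//.
by rewrite unitmxE unitfE det_model_diag mulr1 expr1n mulr1 oppr_eq0 oner_eq0.
Qed.

End InfinityArc.

Lemma norm_segment_le (R : realType) (V : normedModType R) (x y : V) (c d : R) :
  0 <= c <= 1 -> `|x| <= d -> `|y| <= d -> `|x + c *: (y - x)| <= d.
Proof.
move=> /andP[c0 c1] xd yd.
have -> : x + c *: (y - x) = (1 - c) *: x + c *: y.
  by rewrite scalerBl scale1r scalerBr addrA addrAC.
apply: le_trans (ler_normD _ _) _.
rewrite !normrZ (ger0_norm c0) ger0_norm ?subr_ge0//.
rewrite [leRHS](_ : d = (1 - c) * d + c * d); last by ring.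
by apply: lerD; rewrite ler_wpM2l// subr_ge0.
Qed.

Lemma linear_agree3 (R : nzRingType) (U V : lmodType R)
    (g h : {linear U -> V}) (x y z : U) (p q : R) :
  g x = h x -> g y = h y -> g z = h z ->
  g (x + p *: y + q *: z) = h (x + p *: y + q *: z).
Proof. by move=> ex ey ez; rewrite !linearD !linearZZ ex ey ez. Qed.

(** * The arc near the reference subspace *)

Section LocalArc.
Context {R : realType} {m k : nat}.
Local Notation n := m.+2.
Local Notation E := 'M[R]_(n + n).
Local Notation i1 := (lift (@ord0 m.+1) (@ord0 m)).
Context (Omega P : E) (F G : 'M[R]_(n, n + n)) (M : set E).
Hypotheses (Os : symplectic Omega) (D : darboux Omega P F G).
Hypotheses (LP : Lagrangian Omega P) (LM : Lagrangian Omega `<=` M).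
Hypotheses (MGr : M `<=` @Gr R n).
Context (rho : E -> E) (a : {linear E -> 'rV[R]_k}) (b : {linear 'rV[R]_k -> E}).
Hypothesis srho : strict_diff rho P (b \o a).
Hypothesis nrho : \forall z \near P, M (rho z) /\ {for z, continuous rho}.
Hypothesis rhoK : \forall z \near P, M z -> rho z = z.
Context (L : 'M[R]_n).
Hypotheses (L0 : forall i j : 'I_n, (i <= j)%N -> L i j = 0) (L1 : L i1 ord0 = 1).
Hypothesis fixedL : b (a (dchart P F G L)) = dchart P F G L.

Local Notation s := (model_path L).
Local Notation v := (@model_dir R m).

(** The family lies in the tangent space of M: apart from a multiple of [L] its terms are
    symmetric. *)
Lemma fixed_model t y : b (a (dchart P F G (s t y))) = dchart P F G (s t y).
Proof.
have fs S : S^T = S -> b (a (dchart P F G S)) = dchart P F G S.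
  exact: (image_dchart_sym Os D LP LM srho rhoK).
exact: (linear_agree3 (g := b \o a \o dchart P F G : {linear 'M[R]_n -> E})
  (h := dchart P F G : {linear 'M[R]_n -> E}) (1 - t ^+ 2) y
  (fs _ (model_diag_sym t 0 1)) fixedL (fs _ (model_dir_sym t))).
Qed.

Lemma near_ref_model (d : R) : 0 < d ->
  \forall X \near (0 : 'M[R]_n), [/\ M (rho (chart F G X)),
    {for chart F G X, continuous rho},
    M (chart F G X) -> rho (chart F G X) = chart F G X,
    `|coordA Omega F G (rho (chart F G X)) - 1%:M| <= d &
    coordA Omega F G (rho (chart F G X)) \in unitmx /\
    coordA Omega F G (chart F G X) \in unitmx].
Proof.
move=> d0; pose Q z := [/\ M (rho z), {for z, continuous rho},
    M z -> rho z = z, `|coordA Omega F G (rho z) - 1%:M| <= d &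
    coordA Omega F G (rho z) \in unitmx /\ coordA Omega F G z \in unitmx].
suff nQ : \forall z \near P, Q z by exact: (@near_chart _ _ _ _ _ _ D LP Q nQ).
have FP : Filter (nbhs P) by exact: nbhs_filter.
have cA0 : coordA Omega F G z @[z --> P] --> (1%:M : 'M[R]_n).
  rewrite -(coordA_ref D LP.1).
  by do 2!(apply: cvg_mulmx; last exact: cvg_cst); apply: cvg_mulmx => [|A];
    first exact: cvg_cst.
have rP := rho_ref LP LM rhoK.
have crho : rho z @[z --> P] --> P.
  have c : rho z @[z --> P] --> rho P := (nbhs_singleton nrho).2.
  by rewrite rP in c.
have cA : coordA Omega F G (rho z) @[z --> P] --> (1%:M : 'M[R]_n).
  exact: (@cvg_comp _ _ _ rho (coordA Omega F G) _ _ _ crho cA0).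
have nA0 : \forall z \near P, coordA Omega F G z \in unitmx.
  exact: (near_unitmx cA0 (unitmx1 _ _)).
have nA : \forall z \near P, coordA Omega F G (rho z) \in unitmx.
  exact: (near_unitmx cA (unitmx1 _ _)).
have nd : \forall z \near P, `|coordA Omega F G (rho z) - 1%:M| <= d.
  by move/cvgrPdist_le : cA => /(_ _ d0); apply: filterS => z; rewrite distrC.
near=> z; have [Mz cz] : M (rho z) /\ {for z, continuous rho} by near: z.
by split=> //; [near: z|near: z|split; near: z].
Unshelve. all: by end_near. Qed.

(** On increments tangent to M the derivative of [coordB \o rho \o chart] is the identity. Tangency
    is asked of [Z] rather than of [x - y] so that the scale [c] can be divided out afterwards. *)
Lemma strict_on_fixed (eta : R) : 0 < eta -> exists2 r : R, 0 < r &
  forall (x y Z : 'M[R]_n) (c : R), `|x| < r -> `|y| < r -> x - y = c *: Z ->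
    b (a (dchart P F G Z)) = dchart P F G Z ->
    `|coordB Omega F (rho (chart F G x)) - coordB Omega F (rho (chart F G y)) -
      c *: Z| <= eta * `|x - y|.
Proof.
move=> eta0; have [r r0 st] := strict_coordB_rho_chart D LP srho eta0.
exists r => // x y Z c xr yr xy fZ.
pose K : {linear 'M[R]_n -> 'M[R]_n} := coordB Omega F \o (b \o a \o dchart P F G).
have KZ : K Z = Z by rewrite -[RHS](coordB_dchart Os D LP.1) -fZ.
have KxyE : K (x - y) = c *: Z by rewrite xy linearZZ KZ.
by have := st x y; rewrite !subr0 -KxyE => /(_ xr yr).
Qed.

(* For small e the map X |-> coordB (rho (chart (e X))) / e is Lipschitz-close to
   the identity on the span of the model family. Its determinant therefore stays
   strictly increasing in y, and its zero f t depends continuously on t; the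
   parameter sin t keeps the path in the compact range [-1, 1]. *)
Lemma rescaled_path : exists (e : R) (f : R -> R),
  0 < e /\ forall (V := fun t => rho (chart F G (e *: s (sin t) (f t)))),
  [/\ continuous V,
   forall t, normal_vectors M P (V t, nfield Omega G (v (sin t)) (V t)) &
   forall t, `|sin t| = 1 ->
     V t = chart F G (e *: model_diag (sin t) 0 1)].
Proof.
have [d /andP[d0 d1] trace_gt] := model_uniform_trace L0 L1.
have [d' d'0 det_lt] := model_uniform_det L0 L1 (divr_gt0 d0 (ltr0n R 2)).
pose C := 2 + `|L|.
have C0 : 0 < C by rewrite ltr_wpDr.
(* [C] bounds the whole family, so a relative error [eta] becomes an absolute error [eta * C] below
   both uniform thresholds. *)
pose eta := Num.min d d' / C.
have eta0 : 0 < eta by rewrite divr_gt0// lt_min d0.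
have etaC : eta * C <= d /\ eta * C <= d'.
  by rewrite /eta divfK ?gt_eqF// !ge_min !lexx orbT.
have eta_d : eta <= d.
  apply: le_trans etaC.1; rewrite ler_peMr ?(ltW eta0)// /C.
  by have := normr_ge0 L; lra.
have [r1 r10 strict] := strict_on_fixed eta0.
have [r2 r20 near2] := cvg_near0_norm (near_ref_model d0).
pose r := Num.min r1 r2; have r0 : 0 < r by rewrite lt_min r10.
(* This scale keeps the whole family inside the ball of radius [r], where both the strict estimate
   and the retraction properties hold. *)
pose e := r / (2 * C); have e0 : 0 < e by rewrite divr_gt0// mulr_gt0.
have eC (X : 'M[R]_n) : `|X| <= C -> `|e *: X| < r.
  move=> XC; rewrite normrZ gtr0_norm//.
  apply: le_lt_trans (ler_wpM2l (ltW e0) XC) _.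
  have -> : e * C = r / 2 by rewrite /e; field; rewrite gt_eqF.
  by rewrite ltr_pdivrMr// ltr_pMr// ltrDl.
move: e e0 eC => e e0 eC.
have sin1 (t : R) : -1 <= sin t <= 1 by rewrite sin_geN1 sin_le1.
have sC t y : `|y| <= 1 -> `|s (sin t) y| <= C by exact: norm_model_path.
pose W t y := rho (chart F G (e *: s (sin t) y)).
pose mu t y := e^-1 *: coordB Omega F (W t y).
pose A t y := coordA Omega F G (W t y).
have small t y : `|y| <= 1 -> `|e *: s (sin t) y| < r2.
  by move=> y1; have := eC _ (sC t y y1); rewrite lt_min => /andP[].
have small1 t y : `|y| <= 1 -> `|e *: s (sin t) y| < r1.
  by move=> y1; have := eC _ (sC t y y1); rewrite lt_min => /andP[].
have muE t y : coordB Omega F (W t y) = e *: mu t y.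
  by rewrite /mu scalerA mulfV ?scale1r// gt_eqF.
have mu_near t y : `|y| <= 1 -> `|mu t y - s (sin t) y| <= eta * C.
  move=> y1.
  have := strict (e *: s (sin t) y) 0 (s (sin t) y) e (small1 t y y1).
  rewrite normr0 => /(_ r10 (subr0 _) (fixed_model _ _)).
  rewrite (chart0 D LP.1) (rho_ref LP LM rhoK) (coordB_ref D LP.1) !subr0.
  rewrite -/(W t y) muE -scalerBr !normrZ mulrCA.
  rewrite ler_pM2l ?normr_gt0 ?gt_eqF//.
  by move=> h; apply: le_trans h _; rewrite ler_wpM2l ?(ltW eta0)// sC.
have sB t y z : s t y - s t z = (y - z) *: v t.
  by rewrite /model_path opprD addrACA subrr add0r -scalerBl.
have fixv t : b (a (dchart P F G (v t))) = dchart P F G (v t).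
  apply: (image_dchart_sym Os D LP LM srho rhoK); exact: model_dir_sym.
have mu_lip t y z : `|y| <= 1 -> `|z| <= 1 ->
    `|mu t y - mu t z - (y - z) *: v (sin t)| <= d * `|y - z|.
  move=> y1 z1.
  have xy : e *: s (sin t) y - e *: s (sin t) z = (e * (y - z)) *: v (sin t).
    by rewrite -scalerBr sB scalerA.
  have := strict _ _ _ _ (small1 t y y1) (small1 t z z1) xy (fixv _).
  rewrite xy -/(W t y) -/(W t z) !muE -scalerA -!scalerBr !normrZ mulrCA.
  rewrite ler_pM2l ?normr_gt0 ?gt_eqF//.
  move=> h; apply: le_trans h _; rewrite mulrCA [leRHS]mulrC ler_wpM2l//.
  apply: le_trans (ler_wpM2l (ltW eta0) (norm_model_dir (sin1 t))) _.
  by rewrite mulr1.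
have trace_mu t y (e' q A' : 'M[R]_n) : `|y| <= d -> `|e'| <= d -> `|q| <= d ->
    `|A' - 1%:M| <= d ->
    2^-1 < \tr (\adj (s (sin t) y + e') *m (A' *m (v (sin t) + q))).
  by move=> yd ed qd Ad; apply: trace_gt.
pose Fn t y := \det (mu t y).
have d_1 (y : R) : `|y| <= d -> `|y| <= 1 by move=> yd; exact: le_trans yd d1.
have Fmono t y z : `|y| <= d -> `|z| <= d -> y < z ->
    (z - y) / 2 <= Fn t z - Fn t y.
  (* The model is affine in [y], so the intermediate matrix of the mean value theorem is a
     perturbation of the model at [yc], and the increment is [z - y] times a perturbation of the
     model direction. The trace bound gives slope at least 1/2. *)
  move=> yd zd yz; have [c c01 Fe] := det_MVT (mu t y) (mu t z).
  have /andP[c0 c1] := c01.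
  have zy : 0 < z - y by rewrite subr_gt0.
  pose q := (z - y)^-1 *: (mu t z - mu t y - (z - y) *: v (sin t)).
  have qd : `|q| <= d.
    rewrite normrZ normfV ler_pdivrMl ?normr_gt0 ?gt_eqF// mulrC.
    by apply: mu_lip; exact: d_1.
  have muq : mu t z - mu t y = (z - y) *: (v (sin t) + q).
    rewrite scalerDr /q scalerA mulfV ?gt_eqF// scale1r.
    exact/esym/subrKC.
  pose yc := y + c * (z - y).
  pose e' := (mu t y - s (sin t) y) +
    c *: ((mu t z - s (sin t) z) - (mu t y - s (sin t) y)).
  have pt : mu t y + c *: (mu t z - mu t y) = s (sin t) yc + e'.
    have -> : s (sin t) yc = s (sin t) y + c *: (s (sin t) z - s (sin t) y).
      have yy : yc - y = c * (z - y) by rewrite /yc; ring.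
      rewrite (sB (sin t) z y) scalerA -yy -(sB (sin t) yc y).
      exact/esym/subrKC.
    rewrite /e'; move: (mu t y) (mu t z) (s (sin t) y) (s (sin t) z).
    by move=> m1 m2 s1 s2; apply/matrixP => i j; rewrite !mxE; ring.
  have ycd : `|yc| <= d by exact: norm_segment_le.
  have ed' : `|e'| <= d.
    by apply: norm_segment_le => //; apply: le_trans etaC.1; apply: mu_near;
      exact: d_1.
  have trZ (X Y : 'M[R]_n) (x : R) : \tr (X *m (x *: Y)) = x * \tr (X *m Y).
    by rewrite -scalemxAr mxtraceZ.
  have trE := etrans (congr2 (fun X Y => \tr (\adj X *m Y)) pt muq) (trZ _ _ _).
  rewrite [leRHS](etrans Fe trE) ler_pM2l//.
  have := @trace_mu t yc e' q 1%:M ycd ed' qd.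
  by rewrite subrr normr0 mul1mx => /(_ (ltW d0)) /ltW.
have zero1 : `|0 : R| <= 1 by rewrite normr0.
(* With slope at least 1/2 the determinant changes by at least [d / 2] between 0 and [d] or [- d];
   starting below [d / 2] in absolute value, it takes both signs. *)
have F0 t : `|Fn t 0| < d / 2.
  have := det_lt (sin t) (mu t 0 - s (sin t) 0) (sin1 t).
  rewrite subrKC; apply; apply: le_trans etaC.2; exact: mu_near.
have dd : `|d| <= d by rewrite gtr0_norm.
have ndd : `|- d| <= d by rewrite normrN.
have zd : `|0 : R| <= d by rewrite normr0 ltW.
have Fpm t : Fn t (- d) < 0 /\ 0 < Fn t d.
  have := F0 t; rewrite ltr_norml => /andP[Fl Fr].
  have nd0 : - d < 0 by rewrite oppr_lt0.
  have := Fmono t _ _ ndd zd nd0; have := Fmono t _ _ zd dd d0.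
  move: (Fn t 0) (Fn t (- d)) (Fn t d) Fl Fr => x0 xm xp.
  by rewrite !subr0 sub0r opprK; split; lra.
have cB (T : Type) (FT : set_system T) (FF : Filter FT) (g : T -> E) (X : E) :
    g @ FT --> X -> coordB Omega F (g x) @[x --> FT] --> coordB Omega F X.
  move=> gX; apply: cvgN.
  by do 2!(apply: cvg_mulmx; last exact: cvg_cst); apply: cvg_mulmx => //;
    exact: cvg_cst.
have cW (T : Type) (FT : set_system T) (FF : Filter FT) (g h : T -> R) (t y : R) :
    `|y| <= 1 -> g @ FT --> t -> h @ FT --> y ->
    W (g x) (h x) @[x --> FT] --> W t y.
  move=> y1 gt hy.
  have c1 : chart F G (e *: s (sin (g x)) (h x)) @[x --> FT] -->
      chart F G (e *: s (sin t) y).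
    apply: (cvg_chart D); apply: cvgZl_tmp; apply: cvg_model_path => //.
    exact: (@cvg_comp _ _ _ g (@sin R) _ _ _ gt (@continuous_sin R t)).
  have [_ c2 _ _ _] := near2 _ (small t y y1).
  exact: (@cvg_comp _ _ _ (fun x => chart F G (e *: s (sin (g x)) (h x))) rho
    _ _ _ c1 c2).
have cF (T : Type) (FT : set_system T) (FF : Filter FT) (g h : T -> R) (t y : R) :
    `|y| <= 1 -> g @ FT --> t -> h @ FT --> y ->
    Fn (g x) (h x) @[x --> FT] --> Fn t y.
  move=> y1 gt hy; apply: cvg_det; apply: cvgZl_tmp; apply: cB; exact: cW.
have [|||f [cf fd ff funiq]] := @implicit_path R Fn d _ _ _ Fpm d0.
- by move=> y yd t; apply: cF; [exact: d_1|exact: cvg_id|exact: cvg_cst].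
- move=> t; apply: continuous_in_subspaceT => y; rewrite inE /= in_itv /= => yd.
  by apply: cF; [apply: d_1; rewrite ler_norml|exact: cvg_cst|exact: cvg_id].
- move=> t y z yd zd' yz; rewrite -subr_gt0.
  by apply: lt_le_trans (Fmono t y z yd zd' yz); rewrite divr_gt0// subr_gt0.
exists e, f; split=> //; move=> V; split.
- by move=> t; apply: cW; [exact: d_1|exact: cvg_id|exact: cf].
- move=> t; have y1 := d_1 _ (fd t).
  have [MV _ _ Ad [Au _]] := near2 _ (small t (f t) y1).
  have [FVf VE] := Gr_frameE (MGr MV) Au.
  (* This multiple of the frame makes [H *m Omega *m F^T] equal to [mu t (f t)], to which the trace
     bound applies; [nfield] sees only the subspace. *)
  pose H := (- e^-1) *: (F *m V t).
  have en : - e^-1 != 0 by rewrite oppr_eq0 invr_eq0 gt_eqF.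
  have Hf : row_free H by rewrite /row_free mxrank_scale_nz.
  have HV : (H <= V t)%MS by rewrite scalemx_sub// submxMl.
  have [VH _] := Gr_sub_eqmx (MGr MV) Hf HV.
  have HF : H *m Omega *m F^T = mu t (f t).
    by rewrite /H /mu -!scalemxAl scaleNr -scalerN.
  have HG : H *m Omega *m G^T = (- e^-1) *: A t (f t).
    by rewrite /H -!scalemxAl.
  have MH : M (proj H) by rewrite -VH.
  have := frame_normal Os D (S := v (sin t)) Hf _ _ MH.
  rewrite -VH HF HG; apply; first exact: ff.
  rewrite -scalemxAl -scalemxAr mxtraceZ mulf_neq0//.
  have := @trace_mu t (f t) (mu t (f t) - s (sin t) (f t)) 0 (A t (f t)) (fd t).
  rewrite normr0 addr0 subrKC => tr; apply: lt0r_neq0.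
  apply: lt_trans (tr _ (ltW d0) Ad); first by rewrite invr_gt0.
  by apply: le_trans etaC.1; exact: mu_near.
- move=> t t1.
  have w0 : 1 - sin t ^+ 2 = 0.
    by rewrite -real_normK ?num_real// t1 expr1n subrr.
  have sE : s (sin t) 0 = model_diag (sin t) 0 1.
    by rewrite /model_path w0 !scale0r !addr0.
  have L0' : Lagrangian Omega (chart F G (e *: s (sin t) 0)).
    by apply: (chart_Lagrangian Os D); rewrite sE linearZ /= model_diag_sym.
  have [_ _ fix0 _ _] := near2 _ (small t 0 zero1).
  have W0 : W t 0 = chart F G (e *: s (sin t) 0) by exact: fix0 (LM L0').
  (* When [sin t] is 1 or -1 the model at [y = 0] is symmetric and singular, so its chart is already
     a point of M on the train; uniqueness of the zero identifies the endpoint. *)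
  suff f0 : 0 = f t by rewrite /V -f0 -/(W t 0) W0 sE.
  apply: funiq => //; rewrite /Fn /mu W0 (coordB_chart Os D) -scalemxAr.
  rewrite scalerA mulVf ?gt_eqF// scale1r det_mulmx sE det_model_diag.
  by rewrite mulr0 mul0r mulr0.
Qed.

End LocalArc.

Lemma no_coorientation (R : realType) (n k : nat) (Omega P : 'M[R]_(n + n))
    (M : set 'M[R]_(n + n)) (o : 'M[R]_(n + n) * 'M[R]_(n + n) -> bool) :
  symplectic Omega -> Lagrangian Omega P -> Lagrangian Omega `<=` M ->
  M `<=` @Gr R n -> connected M -> smooth_submanifold k M ->
  Lagrangian Omega <> M -> ~ coorientation M P o.
Proof.
move=> Os LP LM MGr Mc Msub LneM co.
have [F [G D]] := darboux_exists Os LP.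
have [rho [a [b [srho abK nrho rhoK]]]] := submanifold_retraction Msub (LM _ LP).
have [w] := nonsymmetric_tangent Os D LP LM MGr Mc Msub LneM srho abK nrho rhoK.
(* For [n] equal to 0 or 1 every square matrix of size [n] is symmetric, which contradicts the
   tangent matrix just found. *)
case: n => [|[|m]] in Omega P M o Os LP LM MGr Mc Msub LneM co F G D rho a b
  srho abK nrho rhoK w *.
- by case; apply/matrixP => -[].
- by case; apply/matrixP => i j; rewrite mxE !ord1.
move=> /(lower_tangent Os D LP LM MGr srho abK nrho rhoK).
move=> [F' [G' [L [D' L0 L1 fixL]]]].
have [e [f [e0 [cV nV Vend]]]] :=
  rescaled_path Os D' LP LM MGr srho nrho rhoK L0 L1 fixL.
have cN : continuous (fun t : R => nfield Omega G' (@model_dir R m (sin t))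
    (rho (chart F' G' (e *: model_path L (sin t) (f t))))).
  move=> t; apply: cvg_nfield; last exact: cV.
  apply: cvg_model_dir; exact: continuous_sin.
have := coorientation_path co nV cV cN (pi / 2) (- (pi / 2)).
have s1 : sin (pi / 2) = 1 :> R by exact: sin_pihalf.
have s2 : sin (- (pi / 2)) = -1 :> R by rewrite sinN s1.
rewrite !Vend ?s1 ?s2 ?normrN ?normr1//.
have -> : @model_dir R m (-1) = - delta_mx (lift ord0 ord0) (lift ord0 ord0).
  by rewrite /model_dir sqrrN expr1n subrr scale0r subr0 scaleN1r.
have -> : @model_dir R m 1 = delta_mx (lift ord0 ord0) (lift ord0 ord0).
  by rewrite /model_dir expr1n subrr scale0r subr0 scale1r.
(* The arc near P ends with the opposite matrix unit. The arc through infinity carries it back to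
   the first endpoint, so [o] takes the same value on a normal vector and on its opposite. *)
rewrite (infinity_arc Os D' LM co e0) nfieldN (coorientation_opp co).
  by case: (o _).
have := nV (pi / 2); rewrite Vend s1 ?normr1//.
by rewrite /model_dir expr1n subrr scale0r subr0 scale1r.
Qed.

Theorem theorem6p3 (R : realType) (n : nat) (n_ge1 : (1 <= n)%N)
    (Omega : 'M[R]_(n + n)) (Omega_sympl : symplectic Omega)
    (P : 'M[R]_(n + n)) (P_Lagr : Lagrangian Omega P)
    (alpha0 : H1 R (set_type (Lagrangian Omega)))
    (alpha0_Maslov : is_Maslov_class alpha0) :
  ~ exists T : MA_triple R n,
      [/\ is_MA_space T,
          proper_extension T (classical_MA P alpha0),
          connected (MA_set T) &
          exists k : nat, smooth_submanifold k (MA_set T)].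
Proof.
move=> [T [[TGr _ _ [c co _]] [[LT [PT _]] LneT] Tc [k Tsub]]].
rewrite /= in LT PT LneT; rewrite -PT in co.
exact: (no_coorientation Omega_sympl P_Lagr LT TGr Tc Tsub LneT co).
Qed.
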